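(* Let $n,m_1,m_2\ge 1$ be integers, let $\mathbf{X}_1,\dots,\mathbf{X}_n\in\mathbb{R}^{m_1\times m_2}$ be deterministic matrices, let $\mathbf{B}^\star\in\mathbb{R}^{m_1\times m_2}$, and let $y_i=\mathrm{Tr}(\mathbf{X}_i^\top\mathbf{B}^\star)+\xi_i$ for $i=1,\dots,n$, where $\boldsymbol\xi=(\xi_1,\dots,\xi_n)^\top$ is drawn from the Gaussian distribution $\mathcal{N}(\mathbf{0}_n,\sigma^2\mathbf{I}_n)$, $\sigma>0$. Let $\tau>0$, $\lambda>0$ and suppose that, for some $\delta\in(0,1)$, $\lambda\ge 2\sigma v_{\mathcal X}\big\{\frac2n\log((m_1+m_2)/\delta)\big\}^{1/2}$. Then, with probability at least $1-\delta$, the exponentially weighted aggregate $\widehat{\mathbf{B}}^{\rm EWA}$ with the nuclear-norm prior satisfies $$\ell_n(\widehat{\mathbf B}^{\rm EWA},\mathbf B^\star)\le\inf_{\substack{\bar{\mathbf B}\in\mathbb{R}^{m_1\times m_2}\\ J\subset[\mathrm{rank}(\bar{\mathbf B})]}}\Big\{\ell_n(\bar{\mathbf B},\mathbf B^\star)+4\lambda\|\mathcal P_{\bar{\mathbf B},J^c}(\bar{\mathbf B})\|_1+\frac{9\lambda^2|J|}{4\kappa_{\bar{\mathbf B},J,3}}\Big\}+2m_1m_2\tau .$$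
   Context: Notation: $\langle\mathbf A,\mathbf B\rangle=\mathrm{Tr}(\mathbf A^\top\mathbf B)$; for a matrix $\mathbf A$, $\|\mathbf A\|_1$ is the nuclear norm (sum of singular values) and $\|\mathbf A\|$ the operator norm (largest singular value); $\|\mathbf A\|_{L_2(\mathcal X)}^2=\frac1n\sum_{i=1}^n\langle\mathbf X_i,\mathbf A\rangle^2$; $[r]=\{1,\dots,r\}$. Prediction loss: $\ell_n(\mathbf B,\mathbf B')=\|\mathbf B-\mathbf B'\|_{L_2(\mathcal X)}^2$. Design constant: $$v_{\mathcal X}=\max\Big\{\Big\|\frac1n\sum_{i=1}^n\mathbf X_i\mathbf X_i^\top\Big\|^{1/2},\ \Big\|\frac1n\sum_{i=1}^n\mathbf X_i^\top\mathbf X_i\Big\|^{1/2}\Big\}.$$ Estimator: $V_n(\mathbf B)=\frac1{2n}\sum_{i=1}^n(y_i-\langle\mathbf X_i,\mathbf B\rangle)^2+\lambda\|\mathbf B\|_1$; the pseudo-posterior is the probability density on $\mathbb{R}^{m_1\times m_2}$ with $\hat\pi_n(\mathbf B)\propto\exp(-V_n(\mathbf B)/\tau)$; $\widehat{\mathbf B}^{\rm EWA}=\int\mathbf B\,\hat\pi_n(\mathbf B)\,d\mathbf B$. Projections: for $\bar{\mathbf B}\in\mathbb{R}^{m_1\times m_2}$ of rank $r$, fix a singular value decomposition $\bar{\mathbf B}=\mathbf V_1\boldsymbol\Sigma\mathbf V_2^\top$, with $\boldsymbol\Sigma$ an $r\times r$ diagonal matrix with positive non-increasing diagonal entries and $\mathbf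 V_j$ an $m_j\times r$ matrix with orthonormal columns ($j=1,2$). For $J\subset[r]$, $\mathbf V_{j,J}$ is the $m_j\times|J|$ matrix consisting of the columns of $\mathbf V_j$ with indices in $J$. For $\mathbf U\in\mathbb{R}^{m_1\times m_2}$, $$\mathcal P_{\bar{\mathbf B},J^c}(\mathbf U)=(\mathbf I_{m_1}-\mathbf V_{1,J}\mathbf V_{1,J}^\top)\mathbf U(\mathbf I_{m_2}-\mathbf V_{2,J}\mathbf V_{2,J}^\top),\qquad \mathcal P^\bot_{\bar{\mathbf B},J^c}(\mathbf U)=\mathbf U-\mathcal P_{\bar{\mathbf B},J^c}(\mathbf U).$$ Compatibility factor: for $c>0$, $$\kappa_{\bar{\mathbf B},J,c}=\inf_{\substack{\mathbf U\in\mathbb{R}^{m_1\times m_2}\\ \|\mathcal P_{\bar{\mathbf B},J^c}(\mathbf U)\|_1<c\|\mathcal P^\bot_{\bar{\mathbf B},J^c}(\mathbf U)\|_1}}\frac{c^2|J|\,\|\mathbf U\|_{L_2(\mathcal X)}^2}{\big(c\|\mathcal P^\bot_{\bar{\mathbf B},J^c}(\mathbf U)\|_1-\|\mathcal P_{\bar{\mathbf B},J^c}(\mathbf U)\|_1\big)^2}.$$ Conventions: $|J|/\kappa_{\bar{\mathbf B},J,c}$ equals $0$ for $J=\varnothing$ (the infimum over the empty set being $+\infty$) and $+\infty$ if $J\neq\varnothing$ and $\kappa_{\bar{\mathbf B},J,c}=0$. *)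

(* Defs.v *)
From HB Require Import structures.
From mathcomp Require Import all_boot all_order all_algebra.
From mathcomp Require Import polyrcf.
From mathcomp Require Import all_classical all_reals all_analysis.
Set Implicit Arguments.
Unset Strict Implicit.
Unset Printing Implicit Defensive.
Import Order.TTheory GRing.Theory Num.Theory.
Import numFieldNormedType.Exports.
Local Open Scope classical_set_scope.
Local Open Scope ring_scope.

Section power_measure.
Context d (T : measurableType d) (R : realType).
Variable mu : {sigma_finite_measure set T -> \bar R}.

Definition cons_pair n (x : T * n.-tuple T) : n.+1.-tuple T :=
  [tuple of x.1 :: x.2].

Lemma measurable_cons_pair n : measurable_fun [set: T * n.-tuple T] (@cons_pair n).
Proof. exact: measurable_cons measurable_fst measurable_snd. Qed.

Section step.
Variables (n : nat) (nu : {sigma_finite_measure set (n.-tuple T) -> \bar R}).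

Definition cons_measure : set (n.+1.-tuple T) -> \bar R :=
  pushforward (mu \x nu)%E (@cons_pair n).

Let cons_measure0 : cons_measure set0 = 0%E.
Proof. by rewrite /cons_measure /pushforward preimage_set0 measure0. Qed.

Let cons_measure_ge0 A : (0 <= cons_measure A)%E.
Proof. by rewrite /cons_measure /pushforward; exact: (measure_ge0 (mu \x nu)%E). Qed.

Let cons_measure_semi_sigma_additive : semi_sigma_additive cons_measure.
Proof.
move=> F mF tF mUF; rewrite /cons_measure /pushforward preimage_bigcup.
have mpre A : measurable A -> measurable (@cons_pair n @^-1` A).
  by move=> mA; rewrite -[X in measurable X]setTI; exact: measurable_cons_pair.
apply: measure_semi_sigma_additive.
- by move=> k; exact: mpre.
- apply/trivIsetP => /= i j _ _ ij; rewrite -preimage_setI.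
  by move/trivIsetP : tF => /(_ _ _ _ _ ij) ->//; rewrite preimage_set0.
- by rewrite -preimage_bigcup; exact: mpre.
Qed.

HB.instance Definition _ := isMeasure.Build _ _ _ cons_measure
  cons_measure0 cons_measure_ge0 cons_measure_semi_sigma_additive.

Let cons_measure_sigma_finite : sigma_finite setT cons_measure.
Proof.
have /sigma_finiteP[F [TF ndF Foo]] := sigma_finiteT mu.
have /sigma_finiteP[G [TG ndG Goo]] := sigma_finiteT nu.
pose g (t : n.+1.-tuple T) : T * n.-tuple T := (thead t, [tuple of behead t]).
have mg : measurable_fun setT g.
  apply/measurable_fun_pairP; split.
    exact: (@measurable_tnth _ T n.+1 ord0).
  exact: measurable_behead.
exists (fun k => g @^-1` (F k `*` G k)).
  apply/seteqP; split => // t _.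
  have [k _ Fk] : (\bigcup_k F k) (g t).1 by rewrite -TF.
  have [l _ Gl] : (\bigcup_k G k) (g t).2 by rewrite -TG.
  exists (maxn k l) => //; split.
    by move: Fk; exact/subsetPset/ndF/leq_maxl.
  by move: Gl; exact/subsetPset/ndG/leq_maxr.
move=> k; have [mF Fk] := Foo k; have [mG Gk] := Goo k; split.
  by rewrite -[X in measurable X]setTI; apply: mg => //; exact: measurableX.
rewrite /cons_measure /pushforward (_ : _ @^-1` _ = F k `*` G k).
  by rewrite product_measure1E// lte_mul_pinfty// ge0_fin_numE.
have gK (xt : T * n.-tuple T) : g (cons_pair xt) = xt.
  case: xt => x t; rewrite /g /cons_pair theadE; congr pair.
  exact: val_inj.
apply/funext => xt; change ((F k `*` G k) (g (cons_pair xt)) = (F k `*` G k) xt).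
by rewrite gK.
Qed.

HB.instance Definition _ := @Measure_isSigmaFinite.Build _ _ _ cons_measure
  cons_measure_sigma_finite.

End step.

(* the n-fold product measure mu \x ... \x mu on n-tuples *)
Fixpoint power_measure n : {sigma_finite_measure set (n.-tuple T) -> \bar R} :=
  match n with
  | 0 => [the {sigma_finite_measure set (0.-tuple T) -> \bar R} of
          dirac [tuple of [::]]]
  | n'.+1 => [the {sigma_finite_measure set (n'.+1.-tuple T) -> \bar R} of
              cons_measure (power_measure n')]
  end.

End power_measure.

Section matrices.
Context (R : realType).

Section svd.
Variables m1 m2 : nat.

(* Square roots of the eigenvalues of A^T A, repeated with multiplicity. There
   are m2 of them: when m2 > m1 the list is padded with zeros, which affects
   neither the sum nor the maximum. *)
Definition singular_values (A : 'M[R]_(m1, m2)) : seq R :=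
  let p := char_poly (A^T *m A) in
  flatten [seq nseq (mup x p) (Num.sqrt x) | x <- rootsR p].

Definition nuclear_norm (A : 'M[R]_(m1, m2)) : R :=
  \sum_(s <- singular_values A) s.

Definition opnorm (A : 'M[R]_(m1, m2)) : R :=
  \big[Num.max/0]_(s <- singular_values A) s.

Definition is_svd r (B : 'M[R]_(m1, m2))
    (V1 : 'M[R]_(m1, r)) (s : 'rV[R]_r) (V2 : 'M[R]_(m2, r)) : Prop :=
  [/\ V1^T *m V1 = 1%:M, V2^T *m V2 = 1%:M,
      forall i, 0 < s 0 i,
      forall i j : 'I_r, (i <= j)%N -> s 0 j <= s 0 i &
      B = V1 *m diag_mx s *m V2^T].

End svd.

Definition cols m r (V : 'M[R]_(m, r)) (J : {set 'I_r}) : 'M[R]_(m, #|J|) :=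
  colsub (@enum_val _ (mem J)) V.

Definition projc m1 m2 r (V1 : 'M[R]_(m1, r)) (V2 : 'M[R]_(m2, r))
    (J : {set 'I_r}) (U : 'M[R]_(m1, m2)) : 'M[R]_(m1, m2) :=
  (1%:M - cols V1 J *m (cols V1 J)^T) *m U
    *m (1%:M - cols V2 J *m (cols V2 J)^T).

Definition projc_perp m1 m2 r (V1 : 'M[R]_(m1, r)) (V2 : 'M[R]_(m2, r))
    (J : {set 'I_r}) (U : 'M[R]_(m1, m2)) : 'M[R]_(m1, m2) :=
  U - projc V1 V2 J U.

Section design.
Variables n m1 m2 : nat.
Implicit Types (X : 'I_n -> 'M[R]_(m1, m2)) (B : 'M[R]_(m1, m2)).

Definition mxdot B B' : R := \tr (B^T *m B').

Definition sqnormL2 X B : R := n%:R^-1 * \sum_i mxdot (X i) B ^+ 2.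

Definition pred_loss X B B' : R := sqnormL2 X (B - B').

Definition design_const X : R :=
  Num.max
    (Num.sqrt (opnorm (n%:R^-1 *: \sum_i X i *m (X i)^T)))
    (Num.sqrt (opnorm (n%:R^-1 *: \sum_i (X i)^T *m X i))).

(* The infimum is taken in \bar R: it is +oo over the empty set (in particular
   for J = set0), and then, as 0^-1 = +oo, +oo^-1 = 0 and 0 * +oo = 0 in \bar R,
   |J| / compat is 0 for J = set0 and +oo when J != set0 and compat = 0. *)
Definition compat X r (V1 : 'M[R]_(m1, r)) (V2 : 'M[R]_(m2, r))
    (J : {set 'I_r}) (c : R) : \bar R :=
  let a U := nuclear_norm (projc V1 V2 J U) in
  let b U := nuclear_norm (projc_perp V1 V2 J U) in
  ereal_inf [set (c ^+ 2 * #|J|%:R * sqnormL2 X U / (c * b U - a U) ^+ 2)%:E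
            | U in [set U : 'M[R]_(m1, m2) | a U < c * b U]].

End design.

Section aggregate.
Variables n m1 m2 : nat.
Variables (X : 'I_n -> 'M[R]_(m1, m2)) (y : 'I_n -> R) (lam tau : R).

Definition mx_of_tuple (t : (m1 * m2).-tuple R) : 'M[R]_(m1, m2) :=
  vec_mx (\row_k tnth t k).

(* Integral with respect to the Lebesgue measure on m1 x m2 matrices, which are
   identified with (m1 * m2)-tuples by [mx_of_tuple]. *)
Definition mx_Rintegral (f : 'M[R]_(m1, m2) -> R) : R :=
  \int[power_measure lebesgue_measure (m1 * m2)]_t f (mx_of_tuple t).

Definition potential (B : 'M[R]_(m1, m2)) : R :=
  (2 * n%:R)^-1 * \sum_i (y i - mxdot (X i) B) ^+ 2 + lam * nuclear_norm B.

Definition pseudo_posterior (B : 'M[R]_(m1, m2)) : R :=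
  expR (- potential B / tau) /
  mx_Rintegral (fun B' => expR (- potential B' / tau)).

Definition EWA : 'M[R]_(m1, m2) :=
  \matrix_(i, j) mx_Rintegral (fun B => B i j * pseudo_posterior B).

End aggregate.

End matrices.

(* N(0, sigma^2 I_n), as the n-fold product of N(0, sigma^2); the parameter
   of [normal_prob] is the standard deviation. *)
Definition iid_normal (R : realType) (n : nat) (sigma : R) :
    set (n.-tuple R) -> \bar R :=
  power_measure (normal_prob 0 sigma) n.

(* Main.v *)
(* The argument has a deterministic and a probabilistic half.

   Deterministic half. Let V be the potential, B^ the aggregate and
   N = m1 * m2. Under the dilation B' |-> (1-s) B + s B' of centre B and ratio
   s < 1, Lebesgue measure scales by s^N, while V is convex, strongly so along
   the design seminorm. Together with 1 + x <= exp x, this gives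
     E V + s/2 E |B' - B|^2 <= V(B) + tau (s^-N - 1) / (1 - s),
   where E is the mean over the pseudo-posterior; let s tend to 1 and apply
   Jensen's inequality to get
     V(B^) + 1/2 |B^ - B|^2 <= V(B) + N tau.
   When the noise matrix sum_i xi_i X_i has operator norm at most n lam / 2, the
   duality of the nuclear and operator norms bounds the noise term, and the
   compatibility factor absorbs lam (3 |P^perp U|_1 - |P U|_1), U = B^ - B.

   Probabilistic half. Let G be the Hermitian dilation of sum_i xi_i X_i.
   Gaussian integration by parts, together with the trace inequality
     tr (H A^q H A^(2r-q)) <= tr (H^2 A^(2r)),
   bounds the moments E tr G^(2p) by those of a scalar Gaussian of variance
   sigma^2 n v_X^2, up to the factor m1 + m2. The Chernoff bound for tr cosh,
   truncated to a finite sum of moments, then controls the operator norm. *)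
From HB Require Import structures.
From mathcomp Require Import all_boot all_order all_algebra.
From mathcomp Require Import polyrcf zify ring lra.
From mathcomp Require Import all_classical all_reals all_analysis measurable_realfun.
Require Import Defs.
Set Implicit Arguments.
Unset Strict Implicit.
Unset Printing Implicit Defensive.
Import Order.TTheory GRing.Theory Num.Theory.
Import numFieldNormedType.Exports.
Local Open Scope classical_set_scope.
Local Open Scope ring_scope.

(** * Trace inner product, singular values and the two matrix norms *)

(** The nuclear norm is defined through the roots of a characteristic polynomial and is not
    differentiable. It is therefore handled in dual form, as the maximum of [mxdot W B] over [W] of
    operator norm at most one, and the singular value decompositions fixed in the theorem supply the
    maximiser. For the same reason the pseudo-posterior is studied by dilations: they use only the
    convexity of the potential, where a divergence formula would differentiate it. On the
    probabilistic side, traces of powers are polynomials in the noise, so integration by parts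
    becomes algebra on monomials and no matrix exponential occurs. The nonzero eigenvalues of a
    Hermitian dilation come in opposite pairs, so a large singular value counts twice in the trace.
    This 2 offsets the one half lost between cosh and exp, which is why the logarithm contains
    [m1 + m2] and not its double. *)

Section frobenius.
Context {R : realType}.
Implicit Types m n p : nat.

Lemma mxdotE m n (A B : 'M[R]_(m, n)) :
  mxdot A B = \sum_i \sum_j A i j * B i j.
Proof.
rewrite /mxdot /mxtrace exchange_big; apply: eq_bigr => j _.
by rewrite mxE; apply: eq_bigr => i _; rewrite mxE.
Qed.

Lemma mxdotC m n (A B : 'M[R]_(m, n)) : mxdot A B = mxdot B A.
Proof. by rewrite /mxdot -mxtrace_tr trmx_mul trmxK. Qed.

Lemma mxdotDr m n (A B C : 'M[R]_(m, n)) :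
  mxdot A (B + C) = mxdot A B + mxdot A C.
Proof. by rewrite /mxdot mulmxDr mxtraceD. Qed.

Lemma mxdotDl m n (A B C : 'M[R]_(m, n)) :
  mxdot (A + B) C = mxdot A C + mxdot B C.
Proof. by rewrite mxdotC mxdotDr !(mxdotC C). Qed.

Lemma mxdotZr m n a (A B : 'M[R]_(m, n)) : mxdot A (a *: B) = a * mxdot A B.
Proof. by rewrite /mxdot -scalemxAr mxtraceZ. Qed.

Lemma mxdotZl m n a (A B : 'M[R]_(m, n)) : mxdot (a *: A) B = a * mxdot A B.
Proof. by rewrite mxdotC mxdotZr mxdotC. Qed.

Lemma mxdotNr m n (A B : 'M[R]_(m, n)) : mxdot A (- B) = - mxdot A B.
Proof. by rewrite -scaleN1r mxdotZr mulN1r. Qed.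

Lemma mxdotNl m n (A B : 'M[R]_(m, n)) : mxdot (- A) B = - mxdot A B.
Proof. by rewrite mxdotC mxdotNr mxdotC. Qed.

Lemma mxdotBr m n (A B C : 'M[R]_(m, n)) :
  mxdot A (B - C) = mxdot A B - mxdot A C.
Proof. by rewrite mxdotDr mxdotNr. Qed.

Lemma mxdotBl m n (A B C : 'M[R]_(m, n)) :
  mxdot (A - B) C = mxdot A C - mxdot B C.
Proof. by rewrite mxdotDl mxdotNl. Qed.

Lemma mxdot0r m n (A : 'M[R]_(m, n)) : mxdot A 0 = 0.
Proof. by rewrite -(scale0r 0) mxdotZr mul0r. Qed.

Lemma mxdot0l m n (A : 'M[R]_(m, n)) : mxdot 0 A = 0.
Proof. by rewrite mxdotC mxdot0r. Qed.

Lemma mxdot_sumr m n (I : Type) (r : seq I) (Q : pred I) A (F : I -> 'M[R]_(m, n)) :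
  mxdot A (\sum_(i <- r | Q i) F i) = \sum_(i <- r | Q i) mxdot A (F i).
Proof.
by apply: (big_morph (mxdot A)); [exact: mxdotDr|exact: mxdot0r].
Qed.

Lemma mxdot_suml m n (I : Type) (r : seq I) (Q : pred I) A (F : I -> 'M[R]_(m, n)) :
  mxdot (\sum_(i <- r | Q i) F i) A = \sum_(i <- r | Q i) mxdot (F i) A.
Proof. by rewrite mxdotC mxdot_sumr; apply: eq_bigr => i _; rewrite mxdotC. Qed.

Lemma mxdot_mull m n p (A : 'M[R]_(m, n)) (B : 'M[R]_(n, p)) C :
  mxdot (A *m B) C = mxdot B (A^T *m C).
Proof. by rewrite /mxdot trmx_mul mulmxA. Qed.

Lemma mxdot_mulr m n p (A : 'M[R]_(m, n)) (B : 'M[R]_(n, p)) C :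
  mxdot (A *m B) C = mxdot A (C *m B^T).
Proof. by rewrite /mxdot trmx_mul -mulmxA mxtrace_mulC mulmxA. Qed.

Lemma mxdot_tr m n (A B : 'M[R]_(m, n)) : mxdot A^T B^T = mxdot A B.
Proof. by rewrite /mxdot trmxK mxtrace_mulC -mxtrace_tr trmx_mul trmxK. Qed.

Lemma mxdot_ge0 m n (A : 'M[R]_(m, n)) : 0 <= mxdot A A.
Proof.
by rewrite mxdotE; apply: sumr_ge0 => i _; apply: sumr_ge0 => j _; rewrite -expr2 sqr_ge0.
Qed.

Lemma mxdot_eq0 m n (A : 'M[R]_(m, n)) : (mxdot A A == 0) = (A == 0).
Proof.
apply/idP/eqP => [|->]; last by rewrite mxdot0r.
rewrite mxdotE psumr_eq0 => [/allP A0|i _]; last first.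
  by apply: sumr_ge0 => j _; rewrite -expr2 sqr_ge0.
apply/matrixP => i j; have /implyP/(_ isT) := A0 i (mem_index_enum _).
rewrite psumr_eq0 => [/allP/(_ j (mem_index_enum _))/implyP/(_ isT)|k _].
  by rewrite -expr2 sqrf_eq0 mxE => /eqP.
by rewrite -expr2 sqr_ge0.
Qed.

Lemma mxdot_gt0 m n (A : 'M[R]_(m, n)) : (0 < mxdot A A) = (A != 0).
Proof. by rewrite lt_def mxdot_eq0 mxdot_ge0 andbT. Qed.

Lemma mxdot_mean m n (A B : 'M[R]_(m, n)) :
  2 * mxdot A B <= mxdot A A + mxdot B B.
Proof.
by have := mxdot_ge0 (A - B); rewrite mxdotBl !mxdotBr (mxdotC B A); lra.
Qed.

Lemma mxdot_CS m n (A B : 'M[R]_(m, n)) :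
  mxdot A B ^+ 2 <= mxdot A A * mxdot B B.
Proof.
have [->|B0] := eqVneq B 0; first by rewrite !mxdot0r expr0n mulr0.
have Bp : 0 < mxdot B B by rewrite mxdot_gt0.
rewrite -subr_ge0 -(pmulr_rge0 _ Bp).
have := mxdot_ge0 (mxdot B B *: A - mxdot A B *: B).
rewrite mxdotBl !mxdotBr !mxdotZl !mxdotZr (mxdotC B A) => /le_trans; apply.
by rewrite le_eqVlt; apply/orP; left; apply/eqP; ring.
Qed.

Lemma mxdot_colsum m n (A B : 'M[R]_(m, n)) :
  mxdot A B = \sum_j mxdot (col j A) (col j B).
Proof.
rewrite mxdotE exchange_big; apply: eq_bigr => j _ /=.
by rewrite mxdotE; apply: eq_bigr => i _; rewrite big_ord1 !mxE.
Qed.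

Lemma mxdot_delta m n i j (A : 'M[R]_(m, n)) : mxdot (delta_mx i j) A = A i j.
Proof.
rewrite mxdotE (bigD1 i)//= (bigD1 j)//= !mxE !eqxx mul1r.
rewrite big1 => [|k kj]; last by rewrite mxE (negbTE kj) andbF mul0r.
rewrite addr0 big1 ?addr0// => k ki; rewrite big1// => l _.
by rewrite mxE (negbTE ki) mul0r.
Qed.

Lemma mxtrace_mul_le m n (M : 'M[R]_m) (C : 'M[R]_(m, n)) (c : R) :
  (forall w : 'cV[R]_m, mxdot w (M *m w) <= c * mxdot w w) ->
  mxdot C (M *m C) <= c * mxdot C C.
Proof.
move=> Mc; rewrite !mxdot_colsum mulr_sumr; apply: ler_sum => j _.
have -> : col j (M *m C) = M *m col j C by rewrite !colE mulmxA.
exact: Mc.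
Qed.

End frobenius.

(** * The nuclear norm read off a singular value decomposition *)

Section nuclear_svd.

(* Both sides are the determinant of [['X, M], [N, 1]] multiplied by a block
   triangular matrix. *)
Lemma char_poly_mulC (R : comNzRingType) m r (M : 'M[R]_(m, r))
    (N : 'M[R]_(r, m)) :
  'X^r * char_poly (M *m N) = 'X^m * char_poly (N *m M).
Proof.
pose Mp := map_mx polyC M; pose Np := map_mx polyC N.
pose K := block_mx 'X%:M Mp Np (1%:M : 'M[{poly R}]_r).
have K1 : K *m block_mx 1%:M 0 (- Np) 1%:M =
    block_mx (char_poly_mx (M *m N)) Mp 0 1%:M.
  rewrite mulmx_block !mulmx1 !mulmx0 !mul1mx add0r mulmxN.
  rewrite /char_poly_mx map_mxM -/Mp -/Np.
  by rewrite subrr add0r.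
have K2 : K *m block_mx 1%:M (- Mp) 0 'X%:M =
    block_mx 'X%:M 0 Np (char_poly_mx (N *m M)).
  rewrite mulmx_block !mulmx1 !mulmx0 !mul1mx !addr0 !mulmxN.
  rewrite /char_poly_mx map_mxM -/Mp -/Np.
  by rewrite mul_scalar_mx mul_mx_scalar addNr addrC.
have := congr1 determinant K1; rewrite det_mulmx det_lblock det_ublock !det1 !mulr1.
have := congr1 determinant K2; rewrite det_mulmx det_lblock det_ublock !det1 mul1r.
by rewrite !det_scalar mulrC /char_poly => <- <-.
Qed.

Context {R : realType}.

Lemma uniq_rootsR (p : {poly R}) : uniq (rootsR p).
Proof. by rewrite /rootsR uniq_roots. Qed.

Lemma mem_rootsR (p : {poly R}) x : p != 0 -> (x \in rootsR p) = root p x.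
Proof. by move=> p0; rewrite -(roots_on_rootsR p0) in_itv. Qed.

Lemma mup_prod (I : Type) (r : seq I) (f : I -> R) x :
  mup x (\prod_(i <- r) ('X - (f i)%:P)) = (\sum_(i <- r) (f i == x))%N.
Proof.
elim: r => [|i r IH]; first by rewrite !big_nil mupNroot// root1.
rewrite !big_cons mupM ?polyXsubC_eq0//.
  by rewrite IH -['X - _]expr1 mup_XsubCX; case: (f i == x).
by rewrite monic_neq0// monic_prod_XsubC.
Qed.

Lemma nuclear_normE m1 m2 (A : 'M[R]_(m1, m2)) :
  nuclear_norm A =
  \sum_(x <- rootsR (char_poly (A^T *m A)))
    (mup x (char_poly (A^T *m A)))%:R * Num.sqrt x.
Proof.
rewrite /nuclear_norm /singular_values big_flatten big_map.
apply: eq_bigr => x _; rewrite big_nseq.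
by rewrite iter_addr_0 mulr_natl.
Qed.

(** [char_poly_mulC] carries [V2] around the product, so the characteristic polynomial of the Gram
    matrix and the product of the factors with roots [s 0 i ^+ 2] agree up to powers of the
    indeterminate. Nonzero roots then have equal multiplicities, and the root 0 contributes nothing
    to either sum. *)
Lemma nuclear_norm_svd m1 m2 r (V1 : 'M[R]_(m1, r)) (s : 'rV[R]_r)
    (V2 : 'M[R]_(m2, r)) :
  V1^T *m V1 = 1%:M -> V2^T *m V2 = 1%:M -> (forall i, 0 <= s 0 i) ->
  nuclear_norm (V1 *m diag_mx s *m V2^T) = \sum_i s 0 i.
Proof.
move=> V11 V21 s0; rewrite nuclear_normE.
set p := char_poly _; pose q := \prod_i ('X - (s 0 i ^+ 2)%:P).
have pq : 'X^r * p = 'X^m2 * q.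
  rewrite /p !trmx_mul trmxK tr_diag_mx !mulmxA.
  rewrite -(mulmxA (V2 *m _) V1^T) V11 mulmx1 -mulmxA.
  rewrite -[V2 *m _ *m _]mulmxA char_poly_mulC -!mulmxA V21 mulmx1.
  congr (_ * _); rewrite char_poly_trig; last first.
    by rewrite mulmx_diag diag_mx_is_trig.
  by apply: eq_bigr => i _; rewrite mulmx_diag !mxE eqxx mulr1n expr2.
have p0 : p != 0 by rewrite monic_neq0// char_poly_monic.
have q0 : q != 0 by rewrite monic_neq0// monic_prod_XsubC.
have mX k x : x != 0 -> mup x ('X^k : {poly R}) = 0%N.
  move=> x0; rewrite -['X]subr0 mup_XsubCX.
  by rewrite eq_sym (negbTE x0).
have mpq x : x != 0 -> mup x p = (\sum_i (s 0 i ^+ 2 == x)%R)%N.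
  move=> x0; rewrite -mup_prod -/q.
  have := congr1 (mup x) pq.
  have Xn0 k : 'X^k != 0 :> {poly R} by rewrite monic_neq0 ?monicXn.
  by rewrite (mupM _ (Xn0 r) p0) (mupM _ (Xn0 m2) q0) !mX.
transitivity (\sum_(x <- rootsR p) \sum_i (s 0 i ^+ 2 == x)%:R * s 0 i).
  apply: eq_bigr => x _; have [->|x0] := eqVneq x 0.
    rewrite sqrtr0 mulr0 big1// => i _; rewrite sqrf_eq0.
    by case: eqP => [->|]; rewrite ?mulr0 ?mul0r.
  rewrite mpq// natr_sum mulr_suml; apply: eq_bigr => i _.
  by case: eqP => [<-|]; rewrite ?mul0r// sqrtr_sqr ger0_norm.
rewrite exchange_big; apply: eq_bigr => i _ /=.
rewrite -mulr_suml; have [->|si0] := eqVneq (s 0 i) 0; first by rewrite mulr0.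
rewrite (bigD1_seq (s 0 i ^+ 2)) ?uniq_rootsR//=.
  rewrite eqxx big1 ?addr0 ?mul1r// => x xsi.
  by rewrite eq_sym (negbTE xsi).
rewrite mem_rootsR//.
have : root ('X^r * p) (s 0 i ^+ 2).
  rewrite pq rootM; apply/orP; right.
  by rewrite /root horner_prod; apply/prodf_eq0; exists i; rewrite ?hornerXsubC ?subrr.
rewrite rootM => /orP[|//].
by rewrite /root hornerXn expf_eq0 sqrf_eq0 (negbTE si0) andbF.
Qed.

End nuclear_svd.

(** * Rayleigh quotients and the operator norm *)

Section opnorm.
Context {R : realType}.

Lemma continuous_quadratic k (M : 'M[R]_k) :
  continuous (fun x : 'rV[R]_k => mxdot x (x *m M)).
Proof.
have -> : (fun x : 'rV[R]_k => mxdot x (x *m M)) =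
    fun x => \sum_j x 0 j * \sum_i x 0 i * M i j.
  apply/funext => x; rewrite mxdotE big_ord1.
  by apply: eq_bigr => j _; rewrite mxE.
apply: continuous_big => [|j _]; first exact: add_continuous.
have coordc i : continuous (fun x : 'rV[R]_k => x 0 i).
  by move=> x; exact: (@coord_continuous R 1 k 0 i x).
move=> x; apply: (@continuousM _ 'rV[R]_k); first exact: coordc.
apply: (@continuous_big _ _ _ _ _ _ 'rV[R]_k) => [|i _ {}x]; first exact: add_continuous.
by apply: (@continuousM _ 'rV[R]_k); [exact: coordc|exact: cst_continuous].
Qed.

(** Maximise the Rayleigh quotient: [A] is the unit sphere, compact as a closed subset of a cube,
    and [mu] is the value at a maximiser [c]. If the residual [h] of the eigenvalue equation were
    nonzero, moving [c] along [h] would raise the quotient to first order. *)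
Lemma symmetric_max_eigenvalue k (M : 'M[R]_k) (w0 : 'rV[R]_k) :
  M^T = M -> w0 != 0 ->
  exists mu (c : 'rV[R]_k), [/\ c != 0, c *m M = mu *: c &
    forall x : 'rV[R]_k, mxdot x (x *m M) <= mu * mxdot x x].
Proof.
move=> Msym w00; pose A := [set x : 'rV[R]_k | mxdot x x = 1].
have Anorm (x : 'rV[R]_k) : x != 0 -> A ((Num.sqrt (mxdot x x))^-1 *: x).
  move=> x0; rewrite /A /= mxdotZl mxdotZr mulrA -expr2 exprVn sqr_sqrtr ?mxdot_ge0//.
  by rewrite mulVf// mxdot_eq0.
have A0 : A !=set0 by eexists; exact: Anorm w00.
have cA : compact A.
  pose B : 'I_k -> set R := fun=> `[-1, 1]%classic.
  apply: subclosed_compact (rV_compact (A := B) _) _.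
  - rewrite (_ : A = (fun x : 'rV[R]_k => mxdot x (x *m 1%:M)) @^-1` [set 1]).
      apply: preimage_closed; last exact: closed_eq.
      by move=> x _; exact: continuous_quadratic.
    by apply/seteqP; split => x; rewrite /A /= mulmx1.
  - by move=> i; exact: segment_compact.
  - move=> x; rewrite /A /B /= => x1 i; rewrite in_itv/= -ler_norml.
    rewrite -(@expr_le1 _ 2)// real_normK ?num_real// -x1 mxdotE big_ord1.
    rewrite (bigD1 i)//= -expr2 lerDl sumr_ge0// => j _.
    by rewrite -expr2 sqr_ge0.
have [c] := EVT_max_rV A0 cA
  (continuous_subspaceT (@continuous_quadratic _ M)).
rewrite inE => Ac cmax; pose mu := mxdot c (c *m M).
have c0 : c != 0 by rewrite -mxdot_eq0 Ac oner_neq0.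
have xmax (x : 'rV[R]_k) : mxdot x (x *m M) <= mu * mxdot x x.
  have [->|x0] := eqVneq x 0; first by rewrite !mxdot0l mulr0.
  have := cmax _ (mem_set (Anorm _ x0)).
  have xp : 0 < mxdot x x by rewrite mxdot_gt0.
  rewrite -scalemxAl mxdotZl mxdotZr mulrA -expr2 exprVn sqr_sqrtr ?mxdot_ge0//.
  by rewrite ler_pdivrMl// mulrC.
exists mu, c; split => //; apply/eqP; rewrite -subr_eq0 -mxdot_eq0.
set h := c *m M - _; have [h0 //|hN0] := eqVneq (mxdot h h) 0.
have hp : 0 < mxdot h h by rewrite lt_def hN0 mxdot_ge0.
(* First order condition at the maximiser [c], in the direction [h]. *)
have step e : 2 * e * mxdot h h <= e ^+ 2 * (mu * mxdot h h - mxdot h (h *m M)).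
  have hx := xmax (c + e *: h).
  have chM : mxdot c (h *m M) = mxdot h (c *m M).
    by rewrite -{1}Msym -mxdot_mulr mxdotC.
  have hcM : mxdot h (c *m M) = mxdot h h + mu * mxdot h c.
    by rewrite {3}/h mxdotBr mxdotZr subrK.
  rewrite mulmxDl -scalemxAl !mxdotDl !mxdotDr !mxdotZl !mxdotZr Ac in hx.
  by rewrite -/mu chM hcM (mxdotC c h) in hx; lra.
pose G := mu * mxdot h h - mxdot h (h *m M).
have G0 : 0 <= G by rewrite subr_ge0.
(* With this step size, [step] says that a positive multiple of [G + 2] is at most 0. The [+ 1]
   keeps the denominator positive when [G = 0]. *)
have := step (mxdot h h / (G + 1)); rewrite -/G.
rewrite -subr_le0 expr2 (_ : _ - _ = (mxdot h h) ^+ 2 / (G + 1) ^+ 2 * (G + 2)).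
  by rewrite leNgt mulr_gt0 ?divr_gt0 ?exprn_gt0// ltr_wpDl.
by field; rewrite gt_eqF// ltr_wpDl.
Qed.

Lemma opnorm_ge0 m1 m2 (A : 'M[R]_(m1, m2)) : 0 <= opnorm A.
Proof. exact: bigmax_ge_id. Qed.

(** The largest eigenvalue [mu] may be negative, but [mu ^+ 2] is an eigenvalue of [M^T *m M], so
    the absolute value of [mu] is among the singular values. *)
Lemma opnorm_quadratic k (M : 'M[R]_k) (w : 'cV[R]_k) :
  M^T = M -> mxdot w (M *m w) <= opnorm M * mxdot w w.
Proof.
move=> Msym; have [->|w0] := eqVneq w 0; first by rewrite !mxdot0l mulr0.
have [|mu [c [c0 cM xmax]]] := @symmetric_max_eigenvalue _ M w^T Msym.
  by rewrite -trmx0 (inj_eq trmx_inj).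
have := xmax w^T; rewrite -{1}Msym -trmx_mul !mxdot_tr => /le_trans; apply.
apply: ler_wpM2r; first exact: mxdot_ge0.
rewrite /opnorm; apply: (bigmax_sup_seq _ `|mu|) => //; last exact: ler_norm.
rewrite /singular_values; set p := char_poly _.
have p0 : p != 0 by rewrite monic_neq0// char_poly_monic.
have rp : root p (mu ^+ 2).
  rewrite -eigenvalue_root_char; apply/eigenvalueP; exists c => //.
  by rewrite Msym mulmxA cM -scalemxAl cM scalerA.
apply/flattenP; exists (nseq (mup (mu ^+ 2) p) (Num.sqrt (mu ^+ 2))).
  by apply/mapP; exists (mu ^+ 2) => //; rewrite mem_rootsR.
rewrite sqrtr_sqr mem_nseq eqxx andbT -XsubC_dvd//.
by rewrite dvdp_XsubCl.
Qed.

End opnorm.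

(** * Duality of the nuclear and operator norms *)

Section duality.
Context {R : realType}.

(* A square-root free way to say that the operator norm of [W] is at most [t]. *)
Definition bilinear_le m1 m2 (t : R) (W : 'M[R]_(m1, m2)) :=
  forall (u : 'cV[R]_m1) (v : 'cV[R]_m2),
    2 * mxdot u (W *m v) <= t * (mxdot u u + mxdot v v).

Lemma bilinear_leN m1 m2 t (W : 'M[R]_(m1, m2)) :
  bilinear_le t W -> bilinear_le t (- W).
Proof.
move=> Wt u v; have := Wt (- u) v.
by rewrite mulNmx mxdotNr !mxdotNl mxdotNr opprK.
Qed.

Lemma bilinear_le_delta m1 m2 i j : bilinear_le 1 (delta_mx i j : 'M[R]_(m1, m2)).
Proof.
move=> u v; rewrite mul1r.
have -> : delta_mx i j *m v = delta_mx i (0 : 'I_1) *m (delta_mx (0 : 'I_1) j *m v).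
  by rewrite mulmxA mul_delta_mx.
rewrite -(trmxK (delta_mx i _)) -mxdot_mull trmx_delta.
have le (k : nat) l (w : 'cV[R]_k) :
    mxdot (delta_mx (0 : 'I_1) l *m w) (delta_mx 0 l *m w) <= mxdot w w.
  rewrite -rowE !mxdotE (bigD1 l)//= big_ord1 !big_ord1 !mxE lerDl.
  by apply: sumr_ge0 => a _; rewrite big_ord1 -expr2 sqr_ge0.
by rewrite (le_trans (mxdot_mean _ _))// lerD.
Qed.

(** Bessel's inequality for the orthonormal columns of [V]: expand the squared norm of the residual
    [u - V *m x]. *)
Lemma isometry_mxdot_le m r (V : 'M[R]_(m, r)) (u : 'cV[R]_m) :
  V^T *m V = 1%:M -> mxdot (V^T *m u) (V^T *m u) <= mxdot u u.
Proof.
move=> VV; set x := V^T *m u; have := mxdot_ge0 (u - V *m x).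
have xx : mxdot (V *m x) (V *m x) = mxdot x x.
  by rewrite mxdot_mull mulmxA VV mul1mx.
have xu : mxdot (V *m x) u = mxdot x x by rewrite mxdot_mull.
by rewrite mxdotBl !mxdotBr xx (mxdotC u) xu; lra.
Qed.

Lemma bilinear_le_isometry m1 m2 r (V1 : 'M[R]_(m1, r)) (V2 : 'M[R]_(m2, r)) :
  V1^T *m V1 = 1%:M -> V2^T *m V2 = 1%:M -> bilinear_le 1 (V1 *m V2^T).
Proof.
move=> V11 V21 u v; rewrite mul1r -mulmxA mxdotC mxdot_mull mxdotC.
by rewrite (le_trans (mxdot_mean _ _))// lerD// isometry_mxdot_le.
Qed.

Section svd.
Variables (m1 m2 r : nat) (V1 : 'M[R]_(m1, r)) (s : 'rV[R]_r) (V2 : 'M[R]_(m2, r)).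
Hypotheses (V11 : V1^T *m V1 = 1%:M) (V21 : V2^T *m V2 = 1%:M).
Hypothesis s0 : forall i, 0 <= s 0 i.

Let B := V1 *m diag_mx s *m V2^T.

Lemma svd_duality t (W : 'M[R]_(m1, m2)) :
  bilinear_le t W -> mxdot W B <= t * nuclear_norm B.
Proof.
move=> Wt; rewrite nuclear_norm_svd// mulr_sumr.
rewrite /B mxdotC mxdot_mulr trmxK mxdot_mull mxdotC mxdotE ler_sum// => i _.
rewrite (bigD1 i)//= big1 ?addr0; last first.
  by move=> j ji; rewrite [X in _ * X]mxE eq_sym (negbTE ji) mulr0.
rewrite [X in _ * X]mxE eqxx mulr1n ler_wpM2r//.
have := Wt (col i V1) (col i V2).
have colV m (V : 'M[R]_(m, r)) : V^T *m V = 1%:M -> mxdot (col i V) (col i V) = 1.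
  move=> /matrixP/(_ i i); rewrite !mxE eqxx mulr1n => <-.
  by rewrite mxdotE; apply: eq_bigr => k _; rewrite big_ord1 !mxE.
rewrite !colV//.
have -> : mxdot (col i V1) (W *m col i V2) = (V1^T *m (W *m V2)) i i.
  rewrite mxdotE mxE; apply: eq_bigr => k _; rewrite big_ord1 !mxE.
  by congr (_ * _); apply: eq_bigr => l _; rewrite mxE.
by lra.
Qed.

Lemma svd_duality_attained : mxdot (V1 *m V2^T) B = nuclear_norm B.
Proof.
rewrite nuclear_norm_svd// /B mxdot_mulr trmxK -mulmxA V21 mulmx1.
rewrite mxdotC mxdot_mull V11 mxdotE; apply: eq_bigr => i _.
rewrite (bigD1 i)//= big1 ?addr0; last first.
  by move=> j ji; rewrite [X in _ * X]mxE eq_sym (negbTE ji) mulr0.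
by rewrite !mxE eqxx mulr1 mulr1n.
Qed.

End svd.
End duality.

Section nuclear_norm.
Context {R : realType} (m1 m2 : nat).
Hypothesis svdP : forall B : 'M[R]_(m1, m2),
  exists r (V1 : 'M[R]_(m1, r)) s (V2 : 'M[R]_(m2, r)), is_svd B V1 s V2.
Implicit Types A B W : 'M[R]_(m1, m2).

Lemma nuclear_norm_ge0 B : 0 <= nuclear_norm B.
Proof.
have [r [V1 [s [V2 [V11 V21 s0 _ ->]]]]] := svdP B.
rewrite nuclear_norm_svd//; last by move=> i; exact: ltW.
by apply: sumr_ge0 => i _; exact: ltW.
Qed.

Lemma nuclear_duality t W B :
  bilinear_le t W -> mxdot W B <= t * nuclear_norm B.
Proof.
move=> Wt; have [r [V1 [s [V2 [V11 V21 s0 _ ->]]]]] := svdP B.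
by apply: svd_duality => // i; exact: ltW.
Qed.

(** With [nuclear_duality], this makes the nuclear norm a maximum of linear forms. Convexity, the
    triangle inequality and the subgradient in Jensen's inequality all come from testing with such a
    [W]. *)
Lemma nuclear_duality_attained B :
  exists2 W, bilinear_le 1 W & mxdot W B = nuclear_norm B.
Proof.
have [r [V1 [s [V2 [V11 V21 s0 _ ->]]]]] := svdP B.
exists (V1 *m V2^T); first exact: bilinear_le_isometry.
by apply: svd_duality_attained => // i; exact: ltW.
Qed.

Lemma nuclear_norm_comb a b A B : 0 <= a -> 0 <= b ->
  nuclear_norm (a *: A + b *: B) <= a * nuclear_norm A + b * nuclear_norm B.
Proof.
move=> a0 b0; have [W W1 <-] := nuclear_duality_attained (a *: A + b *: B).
rewrite mxdotDr !mxdotZr lerD// ler_wpM2l// (le_trans (nuclear_duality _ W1))//.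
  by rewrite mul1r.
by rewrite mul1r.
Qed.

Lemma ler_nuclear_normD A B :
  nuclear_norm (A + B) <= nuclear_norm A + nuclear_norm B.
Proof.
have := @nuclear_norm_comb 1 1 A B ler01 ler01.
by rewrite !scale1r !mul1r.
Qed.

Lemma bilinear_le_entry W i j : bilinear_le 1 W -> `|W i j| <= 1.
Proof.
move=> W1; have Wij : mxdot (delta_mx i 0) (W *m delta_mx j (0 : 'I_1)) = W i j.
  by rewrite mxdot_delta -colE mxE.
rewrite ler_norml; apply/andP; split.
  have := bilinear_leN W1 (delta_mx i 0) (delta_mx j 0).
  by rewrite mulNmx mxdotNr Wij !mxdot_delta !mxE !eqxx/=; lra.
have := W1 (delta_mx i 0) (delta_mx j 0).
by rewrite Wij !mxdot_delta !mxE !eqxx/=; lra.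
Qed.

Lemma nuclear_norm_le_sum A : nuclear_norm A <= \sum_i \sum_j `|A i j|.
Proof.
have [W W1 <-] := nuclear_duality_attained A.
rewrite mxdotE ler_sum// => i _; rewrite ler_sum// => j _.
rewrite (le_trans (ler_norm _))// normrM -[leRHS]mul1r ler_wpM2r//.
exact: bilinear_le_entry.
Qed.

(** Together with [nuclear_norm_le_sum], this compares the nuclear norm with the entrywise l1 norm,
    on which the integrability of the pseudo-posterior rests. *)
Lemma entry_le_nuclear_norm A i j : `|A i j| <= nuclear_norm A.
Proof.
have d1 := @bilinear_le_delta R m1 m2 i j.
have := nuclear_duality A d1; have := nuclear_duality A (bilinear_leN d1).
by rewrite mxdotNl !mxdot_delta mul1r ler_norml => ? ->; rewrite andbT; lra.
Qed.

(** * The projections attached to a singular value decomposition *)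

Section projection.
Variables (r : nat) (V1 : 'M[R]_(m1, r)) (s : 'rV[R]_r) (V2 : 'M[R]_(m2, r)).
Variables (B : 'M[R]_(m1, m2)) (J : {set 'I_r}).
Hypothesis svdB : is_svd B V1 s V2.

Let E : 'M[R]_r := diag_mx (\row_i (i \in J)%:R).

Let ET : E^T = E. Proof. exact: tr_diag_mx. Qed.

Let EE : E *m E = E.
Proof.
rewrite mulmx_diag; congr diag_mx; apply/rowP => i; rewrite !mxE.
by case: (i \in J); rewrite ?mul1r ?mul0r.
Qed.

(** Trades a column selection, whose type depends on [#|J|], for a 0-1 diagonal matrix of fixed
    size. The projector identities then reduce to [E *m E = E]. *)
Lemma cols_mulmx_tr m (V : 'M[R]_(m, r)) :
  cols V J *m (cols V J)^T = V *m diag_mx (\row_i (i \in J)%:R) *m V^T.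
Proof.
apply/matrixP => i j; rewrite !mxE.
transitivity (\sum_(k in J) V i k * V j k).
  by rewrite [RHS]big_enum_val; apply: eq_bigr => k _; rewrite !mxE.
rewrite big_mkcond; apply: eq_bigr => k _; rewrite mul_mx_diag !mxE.
by case: (k \in J); rewrite ?mulr1 // mulr0 mul0r.
Qed.

Let compl m (V : 'M[R]_(m, r)) : 'M[R]_m := 1%:M - V *m E *m V^T.

Let complT m (V : 'M[R]_(m, r)) : (compl V)^T = compl V.
Proof.
by rewrite /compl linearB /= trmx1 !trmx_mul trmxK ET mulmxA.
Qed.

Let projcE U : projc V1 V2 J U = compl V1 *m U *m compl V2.
Proof. by rewrite /projc !cols_mulmx_tr. Qed.

Let complV m (V : 'M[R]_(m, r)) : V^T *m V = 1%:M -> compl V *m V = V *m (1%:M - E).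
Proof.
by move=> VV; rewrite /compl mulmxBl mul1mx -(mulmxA _ V^T) VV mulmx1 mulmxBr mulmx1.
Qed.

Let compl_idem m (V : 'M[R]_(m, r)) : V^T *m V = 1%:M -> compl V *m compl V = compl V.
Proof.
move=> VV; rewrite {2}/compl mulmxBr mulmx1 !mulmxA complV//.
rewrite -(mulmxA V) mulmxBl mul1mx EE subrr mulmx0 mul0mx.
by rewrite subr0.
Qed.

Let pythagoras m (V : 'M[R]_(m, r)) (u : 'cV[R]_m) : V^T *m V = 1%:M ->
  mxdot (E *m (V^T *m u)) (E *m (V^T *m u)) + mxdot (compl V *m u) (compl V *m u)
  = mxdot u u.
Proof.
move=> VV; rewrite (mxdot_mull (compl V)) complT (mulmxA (compl V)) compl_idem//.
rewrite (mxdot_mull E) ET (mulmxA E E) EE mxdot_mull trmxK /compl mulmxBl mul1mx.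
by rewrite mxdotBr !mulmxA addrC subrK.
Qed.

(** [W] is a dual certificate: on the singular directions in [J] it is optimal for [B], on the
    complementary block it is built from [W2], optimal for [PU]. Testing [C = B + U] with [W] gains
    the norm of [PU] and loses at most that of the perpendicular part. It misses the norm of [B]
    only through [PB], by at most twice the norm of [PB]. *)
Lemma nuclear_norm_projection C :
  nuclear_norm B - nuclear_norm C <=
  nuclear_norm (projc_perp V1 V2 J (C - B)) - nuclear_norm (projc V1 V2 J (C - B))
  + 2 * nuclear_norm (projc V1 V2 J B).
Proof.
have [V11 V21 s0 _ defB] := svdB.
set U := C - B; set PU := projc V1 V2 J U; set PB := projc V1 V2 J B.
have [W2 W21 W2PU] := nuclear_duality_attained PU.
pose W3 := compl V1 *m W2 *m compl V2.
pose W := V1 *m E *m V2^T + W3.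
(* The two summands of [W] act between orthogonal pairs of subspaces, so by [pythagoras] each is
   charged to its own share of the squared norms of [u] and [v]. *)
have W1 : bilinear_le 1 W.
  move=> u v; rewrite mul1r mulmxDl mxdotDr mulrDr.
  rewrite -(pythagoras u V11) -(pythagoras v V21).
  have -> : mxdot u (V1 *m E *m V2^T *m v) = mxdot (E *m (V1^T *m u)) (E *m (V2^T *m v)).
    by rewrite !mxdot_mull trmxK ET !mulmxA -(mulmxA V1 E E) EE.
  have -> : mxdot u (W3 *m v) = mxdot (compl V1 *m u) (W2 *m (compl V2 *m v)).
    by rewrite mxdot_mull complT !mulmxA.
  have := W21 (compl V1 *m u) (compl V2 *m v).
  have := mxdot_mean (E *m (V1^T *m u)) (E *m (V2^T *m v)).
  by rewrite mul1r; lra.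
have projW D : mxdot W3 D = mxdot W2 (projc V1 V2 J D).
  by rewrite projcE /W3 mxdot_mulr complT mxdot_mull complT mulmxA.
have projI D : projc V1 V2 J (projc V1 V2 J D) = projc V1 V2 J D.
  rewrite !projcE !mulmxA compl_idem// -!mulmxA compl_idem//.
have cV1 : compl V1 *m (V1 *m E) = 0.
  by rewrite mulmxA complV// -mulmxA mulmxBl mul1mx EE subrr mulmx0.
have WPU : mxdot W PU = nuclear_norm PU.
  rewrite mxdotDl projW projI W2PU -[RHS]add0r; congr (_ + _).
  rewrite /PU projcE mxdotC -(mulmxA (compl V1)) mxdot_mull complT.
  by rewrite (mulmxA (compl V1)) cV1 mul0mx mxdot0r.
have WB : mxdot W B = mxdot (V1 *m E *m V2^T) B + mxdot W2 PB.
  by rewrite mxdotDl projW.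
(* Split the optimal matrix [V1 *m V2^T] along [E] and [1%:M - E]; the second part sees [B] only
   through [PB]. *)
have nB : nuclear_norm B = mxdot (V1 *m E *m V2^T) B + mxdot (V1 *m V2^T) PB.
  have -> : mxdot (V1 *m V2^T) PB = mxdot (V1 *m (1%:M - E) *m V2^T) B.
    rewrite /PB projcE mxdotC mxdot_mulr mxdot_mull !complT mxdotC.
    rewrite !mulmxA complV//; congr mxdot.
    rewrite -(mulmxA _ V2^T) -{1}(complT V2) -trmx_mul complV// trmx_mul.
    have -> : (1%:M - E)^T = 1%:M - E by rewrite linearB /= trmx1 ET.
    rewrite !mulmxA -(mulmxA V1); congr (_ *m _ *m _).
    by rewrite mulmxBl mul1mx mulmxBr mulmx1 EE subrr subr0.
  rewrite -mxdotDl -mulmxDl -mulmxDr addrC subrK mulmx1 defB.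
  by rewrite svd_duality_attained// => i; exact: ltW.
have WC : mxdot W C = mxdot W PU + mxdot W (projc_perp V1 V2 J U) + mxdot W B.
  by rewrite -!mxdotDr /projc_perp -/PU [PU + _]addrC subrK /U subrK.
have := nuclear_duality C W1; rewrite mul1r WC WPU WB.
have := nuclear_duality (projc_perp V1 V2 J U) (bilinear_leN W1).
have := nuclear_duality PB (bilinear_leN W21).
have := nuclear_duality PB (bilinear_le_isometry V11 V21).
rewrite !mxdotNl !mul1r nB.
move: (nuclear_norm C) (nuclear_norm PU) (nuclear_norm PB) (nuclear_norm _).
move: (mxdot W _) (mxdot W2 _) (mxdot _ PB) (mxdot _ B); clear=> *.
by lra.
Qed.

End projection.
End nuclear_norm.

(** * Traces of powers of symmetric matrices *)

Section trace_powers.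
Context {R : realType}.

Lemma convex_seq_le_max (f : nat -> R) r :
  (forall a, (a.+2 <= r)%N -> 2 * f a.+1 <= f a + f a.+2) ->
  forall a, (a <= r)%N -> f a <= Num.max (f 0%N) (f r).
Proof.
elim: r => [|r IH] cf a; first by rewrite leqn0 => /eqP ->; rewrite le_max lexx.
have {}IH b : (b <= r)%N -> f b <= Num.max (f 0%N) (f r).
  by apply: IH => c cr; apply: cf; exact: leqW.
rewrite leq_eqVlt => /predU1P[->|]; first by rewrite le_max lexx orbT.
rewrite ltnS => ar; rewrite (le_trans (IH _ ar))// ge_max le_max lexx /=.
case: r IH ar cf => [|r] IH ar cf; first by rewrite le_max lexx.
have := cf r (ltnSn _); have := IH r (leqnSn _); rewrite !le_max.
by move=> /orP[h1 h2|h1 h2]; case: (leP (f r.+1) (f 0%N)) => //= h3; lra.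
Qed.

Lemma trmx_exp k (A : 'M[R]_k) p : A^T = A -> (A ^+ p)^T = A ^+ p.
Proof.
move=> AT; elim: p => [|p IH]; first by rewrite !expr0 trmx1.
by rewrite [in LHS]exprS -[A * _]/(A *m _) trmx_mul IH AT -[_ *m _]/(_ * A) -exprSr.
Qed.

Lemma expmx0 k (A : 'M[R]_k) : A ^+ 0 = 1%:M.
Proof. by []. Qed.

Lemma mulmx_exp k (A : 'M[R]_k) p q : A ^+ p *m A ^+ q = A ^+ (p + q).
Proof. by rewrite exprD. Qed.

(* Log-convexity, by Cauchy-Schwarz, of [q |-> \tr (H *m A ^+ q *m H *m A ^+ (2 * r - q))]. *)
Lemma mxtrace_sandwich_le k (A H : 'M[R]_k) r q : A^T = A -> H^T = H ->
  (q <= r + r)%N ->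
  \tr (H *m A ^+ q *m H *m A ^+ (r + r - q)) <= \tr (H *m H *m A ^+ (r + r)).
Proof.
move=> AT HT qr; pose M a := A ^+ (r - a) *m H *m A ^+ a.
have MM a b : (a <= r)%N -> (b <= r)%N ->
    mxdot (M a) (M b) = \tr (H *m A ^+ (a + b) *m H *m A ^+ (r + r - (a + b))).
  move=> ar br; transitivity
    (\tr (A ^+ a *m (H *m A ^+ (r - a) *m A ^+ (r - b) *m H) *m A ^+ b)).
    by rewrite /mxdot /M !trmx_mul !trmx_exp// HT !mulmxA.
  rewrite mxtrace_mulC (mulmxA (A ^+ b)) mulmx_exp -(mulmxA H) mulmx_exp.
  rewrite mulmxA mxtrace_mulC (mulmxA H) -[in RHS](mulmxA (H *m _)).
  have -> : (r - a + (r - b) = r + r - (a + b))%N by lia.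
  by rewrite addnC.
pose F a := mxdot (M a) (M a).
have Fle a : (a <= r)%N -> F a <= F 0%N.
  move=> ar; have Fr : F r = F 0%N.
    rewrite /F !MM// addn0 subnn subn0 !expmx0 !mulmx1.
    by rewrite mxtrace_mulC mulmxA.
  rewrite -[leRHS]maxxx -{2}Fr; apply: convex_seq_le_max ar => b br.
  rewrite /F (_ : mxdot (M b.+1) _ = mxdot (M b) (M b.+2)) ?mxdot_mean//.
  by rewrite !MM ?addSnnS// ltnW// ltnW.
(* For odd [q] the trace is not a value of [F] but the inner product of two neighbouring [M], at
   most the mean of two values of [F]. *)
pose a := q./2; have ar : (a <= r)%N by rewrite /a; lia.
have br : (q - a <= r)%N.
  by rewrite /a; lia.
have -> : \tr (H *m A ^+ q *m H *m A ^+ (r + r - q)) = mxdot (M a) (M (q - a)%N).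
  by rewrite MM// subnKC//; rewrite /a; lia.
have -> : \tr (H *m H *m A ^+ (r + r)) = F 0%N.
  by rewrite /F MM// addn0 expmx0 mulmx1 subn0.
have := mxdot_mean (M a) (M (q - a)%N); have := Fle _ ar; have := Fle _ br.
by rewrite /F; lra.
Qed.

(** Cauchy-Schwarz row by row. It turns the growth of a single vector under a matrix power into a
    lower bound on a trace. *)
Lemma mxdot_mulmx_le m k (M : 'M[R]_(m, k)) (u : 'cV[R]_k) :
  mxdot (M *m u) (M *m u) <= mxdot M M * mxdot u u.
Proof.
rewrite mxdotE [mxdot M M]mxdotE mulr_suml; apply: ler_sum => i _.
rewrite big_ord1 -expr2.
have -> : (M *m u) i 0 = mxdot (row i M)^T u.
  by rewrite mxdotE mxE; apply: eq_bigr => j _; rewrite big_ord1 !mxE.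
rewrite (le_trans (mxdot_CS _ _))// ler_wpM2r ?mxdot_ge0//.
rewrite mxdotE ler_sum// => j _.
by rewrite big_ord1 !mxE.
Qed.

Lemma mxdot_row_mx m k1 k2 (A C : 'M[R]_(m, k1)) (B D : 'M[R]_(m, k2)) :
  mxdot (row_mx A B) (row_mx C D) = mxdot A C + mxdot B D.
Proof.
rewrite !mxdotE -big_split /=; apply: eq_bigr => i _; rewrite big_split_ord.
by congr (_ + _); apply: eq_bigr => j _; rewrite ?row_mxEl ?row_mxEr.
Qed.

Lemma mxdot_col_mx k m1 m2 (A C : 'M[R]_(m1, k)) (B D : 'M[R]_(m2, k)) :
  mxdot (col_mx A B) (col_mx C D) = mxdot A C + mxdot B D.
Proof. by rewrite -mxdot_tr !tr_col_mx mxdot_row_mx !mxdot_tr. Qed.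

(* The moments [|G ^+ p z|^2] of a symmetric matrix are log-convex in [p]. *)
Lemma symmetric_moment_ge k (G : 'M[R]_k) (z : 'cV[R]_k) t p : G^T = G ->
  0 < t -> z != 0 -> t ^+ 2 * mxdot z z <= mxdot (G *m z) (G *m z) ->
  t ^+ (2 * p) * mxdot z z <= mxdot (G ^+ p *m z) (G ^+ p *m z).
Proof.
move=> GT t0 z0 Gz; pose b p := mxdot (G ^+ p *m z) (G ^+ p *m z).
have b0 : b 0%N = mxdot z z by rewrite /b expr0 mul1mx.
suff : t ^+ (2 * p) * mxdot z z <= b p /\ t ^+ 2 * b p <= b p.+1 by case.
elim: p => [|p [IH1 IH2]]; first by rewrite muln0 expr0 mul1r b0 /b expr1.
have t2 : 0 < t ^+ 2 by rewrite exprn_gt0.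
have zz : 0 < mxdot z z by rewrite mxdot_gt0.
split.
  rewrite mulnS exprD -mulrA (le_trans _ IH2)// ler_wpM2l// ltW//.
have bp0 : 0 < b p by rewrite (lt_le_trans _ IH1)// mulr_gt0// exprn_gt0.
have mE a c : mxdot (G ^+ a *m z) (G ^+ c *m z) = mxdot z (G ^+ (a + c) *m z).
  by rewrite mxdot_mull trmx_exp// mulmxA mulmx_exp.
have bb : b p.+1 ^+ 2 <= b p * b p.+2.
  rewrite (_ : b p.+1 = mxdot (G ^+ p *m z) (G ^+ p.+2 *m z)); first exact: mxdot_CS.
  by rewrite /b !mE addSnnS.
have : t ^+ 2 * b p * b p.+1 <= b p.+1 ^+ 2.
  by rewrite expr2 ler_wpM2r// mxdot_ge0.
move=> /le_trans/(_ bb).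
by rewrite -mulrA mulrCA ler_pM2l.
Qed.

Definition dilation m1 m2 (A : 'M[R]_(m1, m2)) : 'M[R]_(m1 + m2) :=
  block_mx 0 A A^T 0.

Lemma trmx_dilation m1 m2 (A : 'M[R]_(m1, m2)) : (dilation A)^T = dilation A.
Proof. by rewrite tr_block_mx !trmx0 trmxK. Qed.

(** A pair violating the bound gives two vectors, [col_mx u 0] and [col_mx 0 v], that [G] stretches
    by at least [t]. They involve the left and the right columns of [G ^+ p] respectively, so each
    half contributes [t ^+ (2 * p)] to the trace. The resulting 2 matches the one in
    [sum_cosh_coeff_ge]. *)
Lemma mxtrace_dilation_ge m1 m2 (A : 'M[R]_(m1, m2)) t p : 0 < t ->
  ~ bilinear_le t A -> 2 * t ^+ (2 * p) <= \tr (dilation A ^+ (p + p)).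
Proof.
move=> t0 /existsNP[u /existsNP[v /negP]]; rewrite -ltNge => uv.
set G := dilation A; have GT : G^T = G := trmx_dilation A.
have uu := mxdot_ge0 u; have vv := mxdot_ge0 v.
pose c := mxdot u (A *m v); rewrite -/c in uv.
have tuv0 : 0 <= t * (mxdot u u + mxdot v v).
  by apply: mulr_ge0; [exact: ltW|exact: addr_ge0].
have c0 : 0 < c by lra.
have u0 : u != 0 by apply: contraTneq c0 => u0; rewrite /c u0 mxdot0l ltxx.
have v0 : v != 0 by apply: contraTneq c0 => v0; rewrite /c v0 mulmx0 mxdot0r ltxx.
have up : 0 < mxdot u u by rewrite mxdot_gt0.
have vp : 0 < mxdot v v by rewrite mxdot_gt0.
(* The arithmetic-geometric mean inequality, squared to avoid roots. *)
have tc : t ^+ 2 * mxdot u u * mxdot v v <= c ^+ 2.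
  have h : (t * (mxdot u u + mxdot v v)) ^+ 2 <= (2 * c) ^+ 2.
    by rewrite ler_sqr ?nnegrE//; lra.
  have : 0 <= t ^+ 2 * (mxdot u u - mxdot v v) ^+ 2 by rewrite mulr_ge0 ?sqr_ge0.
  by move: h; rewrite !exprMn; nra.
have Cu : t ^+ 2 * mxdot u u <= mxdot (A^T *m u) (A^T *m u).
  rewrite -(ler_pM2r vp) (le_trans tc)// /c.
  rewrite (_ : mxdot u _ = mxdot (A^T *m u) v); first exact: mxdot_CS.
  by rewrite mxdot_mull trmxK.
have Cv : t ^+ 2 * mxdot v v <= mxdot (A *m v) (A *m v).
  rewrite -(ler_pM2l up) mulrCA mulrA (le_trans tc)//.
  exact: mxdot_CS.
have z1 : G *m col_mx u 0 = col_mx 0 (A^T *m u).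
  by rewrite /G /dilation mul_block_col !(mulmx0, mul0mx) !addr0.
have z2 : G *m col_mx 0 v = col_mx (A *m v) 0.
  by rewrite /G /dilation mul_block_col !(mulmx0, mul0mx) add0r addr0.
pose C := G ^+ p; rewrite -mulmx_exp -{1}(trmx_exp p GT) -/C.
have -> : \tr (C^T *m C) = mxdot (lsubmx C) (lsubmx C) + mxdot (rsubmx C) (rsubmx C).
  by rewrite -mxdot_row_mx hsubmxK.
have Cz1 : C *m col_mx u 0 = lsubmx C *m u.
  by rewrite -{1}(hsubmxK C) mul_row_col mulmx0 addr0.
have Cz2 : C *m col_mx 0 v = rsubmx C *m v.
  by rewrite -{1}(hsubmxK C) mul_row_col mulmx0 add0r.
have h1 : t ^+ (2 * p) <= mxdot (lsubmx C) (lsubmx C).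
  rewrite -(ler_pM2r up) (le_trans _ (mxdot_mulmx_le _ _))// -Cz1.
  have -> : mxdot u u = mxdot (col_mx u 0) (col_mx u (0 : 'cV[R]_m2)).
    by rewrite mxdot_col_mx mxdot0r addr0.
  apply: symmetric_moment_ge => //.
    by rewrite col_mx_eq0 (negbTE u0).
  by rewrite z1 !mxdot_col_mx !mxdot0r addr0 add0r.
have h2 : t ^+ (2 * p) <= mxdot (rsubmx C) (rsubmx C).
  rewrite -(ler_pM2r vp) (le_trans _ (mxdot_mulmx_le _ _))// -Cz2.
  have -> : mxdot v v = mxdot (col_mx 0 v) (col_mx (0 : 'cV[R]_m1) v).
    by rewrite mxdot_col_mx mxdot0r add0r.
  apply: symmetric_moment_ge => //.
    by rewrite col_mx_eq0 (negbTE v0) andbF.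
  by rewrite z2 !mxdot_col_mx !mxdot0r addr0 add0r.
by lra.
Qed.

End trace_powers.

(** * Integration against powers of a measure *)

Section power_measure_integral.
Context d (T : measurableType d) (R : realType).
Variable mu : {sigma_finite_measure set T -> \bar R}.

Lemma ge0_integral_power_measureS n (f : n.+1.-tuple T -> \bar R) :
  measurable_fun setT f -> (forall t, 0 <= f t)%E ->
  (\int[power_measure mu n.+1]_t f t =
   \int[mu]_x \int[power_measure mu n]_t f (cons_pair (x, t)))%E.
Proof.
move=> mf f0.
transitivity (\int[pushforward (mu \x power_measure mu n) (@cons_pair _ T n)]_t f t)%E.
  by [].
rewrite ge0_integral_pushforward//; last first.
  exact: measurable_cons_pair.
rewrite preimage_setT (@fubini_tonelli1 _ _ _ _ _ mu (power_measure mu n))//.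
  exact: measurableT_comp mf (@measurable_cons_pair _ _ n).
by move=> x; exact: f0.
Qed.

Lemma integrable_power_measureS n (f : n.+1.-tuple T -> \bar R) :
  measurable_fun setT f ->
  (power_measure mu n.+1).-integrable setT f ->
  (mu \x power_measure mu n)%E.-integrable setT (f \o @cons_pair _ T n).
Proof.
move=> mf /integrableP[_ fi]; apply/integrableP; split.
  exact: measurableT_comp mf (@measurable_cons_pair _ _ n).
move: fi; rewrite ge0_integral_power_measureS//; last exact: measurableT_comp.
by rewrite fubini_tonelli1//; apply: measurableT_comp => //; exact: measurableT_comp mf (@measurable_cons_pair _ _ n).
Qed.

Lemma integral_power_measureS n (f : n.+1.-tuple T -> \bar R) :
  (power_measure mu n.+1).-integrable setT f ->
  (\int[power_measure mu n.+1]_t f t =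
   \int[mu]_x \int[power_measure mu n]_t f (cons_pair (x, t)))%E.
Proof.
move=> fi; have mf := measurable_int _ fi.
transitivity (\int[pushforward (mu \x power_measure mu n) (@cons_pair _ T n)]_t f t)%E.
  by [].
have gi := integrable_power_measureS mf fi.
rewrite integral_pushforward//; last exact: measurable_cons_pair.
by rewrite preimage_setT -integral12_prod_meas1.
Qed.

Lemma integral_power_measure0 (f : 0.-tuple T -> \bar R) :
  (\int[power_measure mu 0]_t f t = f [tuple])%E.
Proof.
rewrite (_ : f = cst (f [tuple])); last by apply/funext => t; rewrite (tuple0 t).
transitivity (\int[\d_([tuple] : 0.-tuple T)]_(t in setT) f [tuple])%E; first by [].
by rewrite integral_cst//= diracE mem_set// mule1.
Qed.

End power_measure_integral.

Section power_measure_product.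
Context d (T : measurableType d) (R : realType).
Variable mu : {sigma_finite_measure set T -> \bar R}.

Lemma tnth_cons_pair0 n (x : T) (t : n.-tuple T) : tnth (cons_pair (x, t)) ord0 = x.
Proof. by []. Qed.

Lemma tnth_cons_pair_lift n (x : T) (t : n.-tuple T) i :
  tnth (cons_pair (x, t)) (lift ord0 i) = tnth t i.
Proof. exact: tnthS. Qed.

Lemma measurable_fun_prod_tnth n (f : 'I_n -> T -> R) :
  (forall i, measurable_fun setT (f i)) ->
  measurable_fun setT (fun t : n.-tuple T => \prod_i f i (tnth t i)).
Proof.
move=> mf; apply: measurable_prod => i _.
by apply: measurableT_comp (mf i) _; exact: measurable_tnth.
Qed.

Lemma ge0_integral_power_measure_prod n (f : 'I_n -> T -> R) (c : 'I_n -> R) :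
  (forall i, measurable_fun setT (f i)) -> (forall i x, 0 <= f i x) ->
  (forall i, (\int[mu]_x (f i x)%:E = (c i)%:E)%E) ->
  (\int[power_measure mu n]_t (\prod_i f i (tnth t i))%:E = (\prod_i c i)%:E)%E.
Proof.
elim: n f c => [|n IH] f c mf f0 fc.
  by rewrite integral_power_measure0 !big_ord0.
rewrite ge0_integral_power_measureS//; first last.
- by move=> t; rewrite lee_fin prodr_ge0.
- by apply/measurable_EFinP; exact: measurable_fun_prod_tnth.
under eq_integral => x _.
  under eq_integral => t _.
    rewrite big_ord_recl tnth_cons_pair0.
    under eq_bigr do rewrite tnth_cons_pair_lift.
    rewrite EFinM; over.
  rewrite ge0_integralZl//; first last.
  - by rewrite lee_fin.
  - by move=> t _; rewrite lee_fin prodr_ge0.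
  - apply/measurable_EFinP.
    exact: (measurable_fun_prod_tnth (f := fun i => f (lift ord0 i))).
  rewrite (IH (fun i => f (lift ord0 i)) (fun i => c (lift ord0 i)))//.
  over.
rewrite ge0_integralZr//; first last.
- by rewrite lee_fin prodr_ge0// => i _; rewrite -lee_fin -fc integral_ge0// => x _; rewrite lee_fin.
- by move=> x _; rewrite lee_fin.
- exact/measurable_EFinP.
by rewrite fc big_ord_recl EFinM.
Qed.

(** The nonnegative product formula applied to absolute values; it licenses Fubini in the signed
    formula below. *)
Lemma integrable_power_measure_prod n (f : 'I_n -> T -> R) :
  (forall i, mu.-integrable setT (EFin \o f i)) ->
  (power_measure mu n).-integrable setT
    (fun t : n.-tuple T => (\prod_i f i (tnth t i))%:E).
Proof.
move=> fi; have mf i : measurable_fun setT (f i).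
  by apply/measurable_EFinP; exact: measurable_int (fi i).
apply/integrableP; split.
  by apply/measurable_EFinP; exact: measurable_fun_prod_tnth.
pose c i := fine (\int[mu]_x `|(f i x)%:E|)%E.
have fc i : (\int[mu]_x `|f i x|%:E = (c i)%:E)%E.
  rewrite fineK// ge0_fin_numE ?integral_ge0//.
  by case/integrableP: (fi i).
under eq_integral do rewrite /= normr_prod.
rewrite (@ge0_integral_power_measure_prod n (fun i x => `|f i x|) c) ?ltry//.
by move=> i; exact: measurableT_comp.
Qed.

Lemma integral_power_measure_prod n (f : 'I_n -> T -> R) (c : 'I_n -> R) :
  (forall i, mu.-integrable setT (EFin \o f i)) ->
  (forall i, (\int[mu]_x (f i x)%:E = (c i)%:E)%E) ->
  (\int[power_measure mu n]_t (\prod_i f i (tnth t i))%:E = (\prod_i c i)%:E)%E.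
Proof.
elim: n f c => [|n IH] f c fi fc.
  by rewrite integral_power_measure0 !big_ord0.
rewrite integral_power_measureS; last exact: integrable_power_measure_prod.
under eq_integral => x _.
  under eq_integral => t _.
    rewrite big_ord_recl tnth_cons_pair0.
    under eq_bigr do rewrite tnth_cons_pair_lift.
    rewrite EFinM; over.
  rewrite integralZl//; last first.
    exact: (@integrable_power_measure_prod n (fun i => f (lift ord0 i))).
  rewrite (IH (fun i => f (lift ord0 i)) (fun i => c (lift ord0 i)))//.
  over.
rewrite integralZr//; last exact: (fi ord0).
by rewrite (fc ord0) big_ord_recl EFinM.
Qed.

End power_measure_product.

(** * Lebesgue measure under affine maps *)

Section lebesgue_scaling.
Context {R : realType}.
Local Notation mu := (@lebesgue_measure R).

Lemma preimage_affine_itv (b s u v : R) : s != 0 ->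
  lebesgue_measure ((fun x => b + s * x) @^-1` `]u, v]) =
  (`|s|^-1%:E * lebesgue_measure `]u, v]%classic)%E.
Proof.
move=> s0; have [sp|] := ltP 0 s.
  rewrite (_ : _ @^-1` _ = `](u - b) / s, (v - b) / s]%classic); last first.
    apply/seteqP; split => x /=; rewrite !in_itv /= ltr_pdivrMr// ler_pdivlMr//;
      by rewrite ltrBlDl lerBrDl mulrC.
  rewrite !lebesgue_measure_itv/= !lte_fin ltr_pM2r ?invr_gt0// ltrD2r gtr0_norm//.
  by case: ifPn => _; rewrite ?mule0// -!EFinD -EFinM; congr EFin; field.
rewrite le_eqVlt (negbTE s0)/= => sn.
rewrite (_ : _ @^-1` _ = `[(v - b) / s, (u - b) / s[%classic); last first.
  apply/seteqP; split => x /=; rewrite !in_itv /= ltr_ndivlMr// ler_ndivrMr//;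
    by rewrite ltrBlDl lerBrDl mulrC andbC.
rewrite !lebesgue_measure_itv/= !lte_fin ltr_nM2r ?invr_lt0// ltrD2r ltr0_norm//.
by case: ifPn => _; rewrite ?mule0// -!EFinD -EFinM; congr EFin; field.
Qed.

(** Uniqueness of Lebesgue measure: the pushforward along [phi], scaled by the absolute value of
    [s], gives half-open intervals their length. Negative [s] is allowed so that reflections are
    covered. *)
Lemma ge0_integral_affine (b s : R) (f : R -> \bar R) : s != 0 ->
  measurable_fun setT f -> (forall x, 0 <= f x)%E ->
  (\int[mu]_x f (b + s * x)%R = `|s|^-1%:E * \int[mu]_x f x)%E.
Proof.
move=> s0 mf f0; pose phi : measurableTypeR R -> measurableTypeR R := fun x => b + s * x.
have mphi : measurable_fun setT phi by apply: measurable_funD => //; exact: measurable_funM.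
pose nu :=
  measure_function_pushforward__canonical__measure_function_Measure mu mphi.
have s1 : 0 <= `|s| by [].
have -> : (\int[mu]_x f x = `|s|%:E * \int[mu]_x f (phi x))%E.
  transitivity (\int[mscale (NngNum s1) nu]_x f x)%E.
    apply: eq_measure_integral => A mA _; apply: lebesgue_measure_unique => // X.
    move=> [[u v] _ <-]; rewrite /mscale /=.
    have e : nu `]u, v]%classic = (`|s|^-1%:E * mu `]u, v]%classic)%E.
      exact: preimage_affine_itv.
    transitivity (`|s|%:E * nu `]u, v]%classic)%E; last by [].
    by rewrite e muleA -EFinM mulfV ?mul1e// normr_eq0.
  rewrite ge0_integral_mscale//; congr (_ * _)%E.
  by rewrite ge0_integral_pushforward.
by rewrite muleA -EFinM mulVf ?mul1e// normr_eq0.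
Qed.

Definition affine_tuple n (b : 'I_n -> R) (s : R) (t : n.-tuple R) : n.-tuple R :=
  [tuple b i + s * tnth t i | i < n].

Lemma measurable_affine_tuple n (b : 'I_n -> R) s :
  measurable_fun setT (affine_tuple b s).
Proof.
apply/measurable_fun_tnthP => i.
rewrite (_ : _ \o _ = fun t => b i + s * tnth t i); last first.
  by apply/funext => t; rewrite /= tnth_mktuple.
by apply: measurable_funD => //; apply: measurable_funM => //; exact: measurable_tnth.
Qed.

Lemma affine_tuple_cons n (b : 'I_n.+1 -> R) s x (t : n.-tuple R) :
  affine_tuple b s (cons_pair (x, t)) =
  cons_pair (b ord0 + s * x, affine_tuple (fun i => b (lift ord0 i)) s t).
Proof.
apply: eq_from_tnth => i; rewrite tnth_mktuple.
case: (unliftP ord0 i) => [j|] ->.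
  by rewrite !tnth_cons_pair_lift tnth_mktuple.
by rewrite !tnth_cons_pair0.
Qed.

Lemma ge0_integral_affine_tuple n (b : 'I_n -> R) (s : R) (f : n.-tuple R -> \bar R) :
  0 < s -> measurable_fun setT f -> (forall t, 0 <= f t)%E ->
  (\int[power_measure mu n]_t f (affine_tuple b s t) =
   (s ^- n)%:E * \int[power_measure mu n]_t f t)%E.
Proof.
move=> s0; elim: n b f => [|n IH] b f mf f0.
  by rewrite !integral_power_measure0 expr0 invr1 mul1e; congr f; rewrite [LHS]tuple0.
have mcons := @measurable_cons_pair _ R n.
pose G x := (\int[power_measure mu n]_t f (cons_pair (x, t)))%E.
have G0 x : (0 <= G x)%E by apply: integral_ge0.
have mG : measurable_fun setT G.
  apply: (@measurable_fun_fubini_tonelli_F _ _ _ _ _ (power_measure mu n)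
    (f \o @cons_pair _ _ n)) => //.
    exact: measurableT_comp mf mcons.
  by move=> x; exact: f0.
have mfx x : measurable_fun setT (fun t => f (cons_pair (x, t))).
  by apply: measurableT_comp mf _; apply: measurableT_comp mcons _; exact: measurable_pair1.
rewrite !ge0_integral_power_measureS//; last first.
  exact: measurableT_comp mf (measurable_affine_tuple _ _).
under eq_integral => x _.
  under eq_integral do rewrite affine_tuple_cons.
  rewrite (IH _ (fun t => f (cons_pair (b ord0 + s * x, t))))//.
  over.
rewrite /=; rewrite (ge0_integralZl _ measurableT); first last.
- by rewrite lee_fin invr_ge0 exprn_ge0// ltW.
- by move=> x _; exact: G0.
- have maff : measurable_fun setT (fun x : R => b ord0 + s * x).
    by apply: measurable_funD => //; exact: measurable_funM.
  exact: measurableT_comp mG maff.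
rewrite (@ge0_integral_affine (b ord0) s G) ?gt_eqF// gtr0_norm//.
by rewrite muleA -EFinM exprSr invfM.
Qed.

End lebesgue_scaling.

(** * Integration against a measure given by a density *)

Section density.
Context d (T : measurableType d) (R : realType).
Variables (mu nu : {measure set T -> \bar R}) (g : T -> R).
Hypotheses (mg : measurable_fun setT g) (g0 : forall x, 0 <= g x).
Hypothesis nuE : forall A, measurable A -> nu A = (\int[mu]_(x in A) (g x)%:E)%E.
Import HBNNSimple.

Let integral_density_nnsfun (h : {nnsfun T >-> R}) :
  (\int[nu]_x (h x)%:E = \int[mu]_x (h x * g x)%:E)%E.
Proof.
have hm y : measurable (h @^-1` [set y]) by exact: measurable_sfunP.
rewrite integralT_nnsfun sintegralE.
transitivity (\int[mu]_x \sum_(y \in range h)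
    (`|y| * (\1_(h @^-1` [set y]) x * g x))%:E)%E; last first.
  apply: eq_integral => x _; rewrite fsumEFin//; congr EFin.
  rewrite fimfunE mulrC mulr_fsumr; apply: eq_fsbigr => y /[!inE] -[z _ <-].
  by rewrite ger0_norm//; ring.
rewrite ge0_integral_fsum//; last 2 first.
- move=> y; apply/measurable_EFinP; apply: measurable_funM => //.
  by apply: measurable_funM.
- by move=> y x _; rewrite lee_fin !mulr_ge0.
apply: eq_fsbigr => y /[!inE] -[z _ <-]; rewrite ger0_norm//.
under [RHS]eq_integral do rewrite EFinM.
rewrite ge0_integralZl//; last 3 first.
- by apply/measurable_EFinP; apply: measurable_funM.
- by move=> x _; rewrite lee_fin mulr_ge0.
- by rewrite lee_fin.
congr (_ * _)%E; rewrite nuE// integral_mkcond; apply: eq_integral => x _.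
rewrite patchE indicE; case: ifPn => _; first by rewrite mul1r.
by rewrite mul0r.
Qed.

Lemma ge0_integral_density (f : T -> R) :
  measurable_fun setT f -> (forall x, 0 <= f x) ->
  (\int[nu]_x (f x)%:E = \int[mu]_x (f x * g x)%:E)%E.
Proof.
move=> mf f0.
have mEf : measurable_fun setT (EFin \o f) by exact/measurable_EFinP.
pose f_ := nnsfun_approx measurableT mEf.
have f_cvg x : (f_ n x)%:E @[n --> \oo] --> (f x)%:E.
  by apply: (cvg_nnsfun_approx measurableT mEf) => // y _; rewrite lee_fin.
have f_nd x : nondecreasing_seq (fun n => (f_ n x)%:E).
  by move=> m n mn; rewrite lee_fin; exact/lefP/nd_nnsfun_approx.
transitivity (lim (\int[nu]_x (f_ n x)%:E @[n --> \oo])%E).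
  rewrite -monotone_convergence//=.
  - by apply: eq_integral => x _; apply/esym/cvg_lim.
  - by move=> n; exact/measurable_EFinP/measurable_funTS.
  - by move=> n x _; rewrite lee_fin.
rewrite [RHS](_ : _ = lim (\int[mu]_x (f_ n x * g x)%:E @[n --> \oo])%E).
  by apply: congr_lim; apply/funext => n; exact: integral_density_nnsfun.
rewrite -monotone_convergence//=.
- apply: eq_integral => x _; apply/esym/cvg_lim => //.
  under eq_fun do rewrite EFinM.
  by rewrite EFinM; apply: cvgeZr.
- by move=> n; apply/measurable_EFinP; apply: measurable_funM.
- by move=> n x _; rewrite lee_fin mulr_ge0.
- by move=> x _ m n mn; rewrite lee_fin ler_wpM2r// -lee_fin f_nd.
Qed.

End density.

(** * Gaussian moments and the tail of a Gaussian matrix series *)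

Section gaussian_moments.
Context {R : realType}.
Local Notation mu := (@lebesgue_measure R).

Let even_gauss (a : R) p x := x ^+ (2 * p) * expR (- (a * x ^+ 2)).

Let even_gauss_ge0 a p x : 0 <= even_gauss a p x.
Proof. by rewrite mulr_ge0 ?expR_ge0// exprM exprn_ge0 ?sqr_ge0. Qed.

Let measurable_even_gauss a p : measurable_fun setT (even_gauss a p).
Proof.
apply: measurable_funM; first exact: measurable_funX.
apply: measurableT_comp => //; apply: measurableT_comp => //.
by apply: measurable_funM => //; exact: measurable_funX.
Qed.

Let normal_pdf_exp s x : s != 0 ->
  normal_pdf 0 s x = normal_peak s * even_gauss (s ^+ 2 *+ 2)^-1 0 x.
Proof.
move=> s0; rewrite normal_pdfE// /normal_fun /even_gauss subr0 mulNr muln0.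
by rewrite expr0 mul1r (mulrC (x ^+ 2)).
Qed.

Let integral_exp_lty b : 0 < b -> (\int[mu]_x (even_gauss b 0 x)%:E < +oo)%E.
Proof.
(* The standard deviation whose normal density decays like [expR (- (b * x ^+ 2))]; finiteness comes
   from its total mass. *)
move=> b0; pose s := Num.sqrt (b *+ 2)^-1.
have s0 : s != 0 by rewrite gt_eqF// sqrtr_gt0 invr_gt0 mulrn_wgt0.
have s2 : (s ^+ 2 *+ 2)^-1 = b.
  rewrite sqr_sqrtr ?invr_ge0 ?mulrn_wge0 ?ltW//.
  by rewrite -mulr_natr -(mulr_natr b) invfM invrK mulfK.
have := integral_normal_pdf 0 s.
under eq_integral do rewrite normal_pdf_exp// s2 EFinM.
rewrite ge0_integralZl//; last 3 first.
- by apply/measurable_EFinP; exact: measurable_even_gauss.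
- by move=> x _; rewrite lee_fin even_gauss_ge0.
- by rewrite lee_fin normal_peak_ge0.
have pk := normal_peak_gt0 s0.
case: (\int[mu]_x _)%E => [r _|/=|]; first exact: ltry.
  by rewrite gt0_muley ?lte_fin.
by rewrite gt0_muleNy ?lte_fin.
Qed.

Let even_gauss_lty a p : 0 < a -> (\int[mu]_x (even_gauss a p x)%:E < +oo)%E.
Proof.
move=> a0; have a20 : 0 < a / 2 by rewrite divr_gt0.
pose C := p`!%:R * (2 / a) ^+ p.
have C0 : 0 <= C by rewrite mulr_ge0// exprn_ge0// divr_ge0// ltW.
apply: (@le_lt_trans _ _ (\int[mu]_x (C * even_gauss (a / 2) 0 x)%:E)%E).
  have mC : measurable_fun setT (fun x => C * even_gauss (a / 2) 0 x).
    by apply: measurable_funM => //; exact: measurable_even_gauss.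
  apply: ge0_le_integral => //.
  - by move=> x _; rewrite lee_fin even_gauss_ge0.
  - by apply/measurable_EFinP; exact: measurable_even_gauss.
  - exact/measurable_EFinP.
  move=> x _; rewrite lee_fin /even_gauss muln0 expr0 mul1r.
  rewrite (_ : - (a * x ^+ 2) = - (a / 2 * x ^+ 2) - (a / 2 * x ^+ 2)); last by field.
  rewrite expRD mulrA ler_wpM2r ?expR_ge0//.
  rewrite expRN ler_pdivrMr ?expR_gt0// /C.
  have y0 : 0 <= a / 2 * x ^+ 2 := mulr_ge0 (ltW a20) (sqr_ge0 x).
  have yp : (a / 2 * x ^+ 2) ^+ p <= p`!%:R * expR (a / 2 * x ^+ 2).
    case: (p) => [|q]; first by rewrite expr0 fact0 mul1r -[leLHS]expR0 ler_expR.
    rewrite [leRHS]mulrC -ler_pdivrMr ?ltr0n ?fact_gt0//.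
    by apply: le_trans (expR_ge1Dxn q y0); rewrite lerDr.
  rewrite (_ : x ^+ (2 * p) = (2 / a) ^+ p * (a / 2 * x ^+ 2) ^+ p); last first.
    by rewrite -exprMn exprM; congr (_ ^+ _); field; rewrite gt_eqF.
  by rewrite (mulrC p`!%:R) -(mulrA _ p`!%:R) ler_wpM2l// exprn_ge0// divr_ge0// ltW.
under eq_integral do rewrite EFinM.
rewrite ge0_integralZl//; last 2 first.
- by apply/measurable_EFinP; exact: measurable_even_gauss.
- by move=> x _; rewrite lee_fin even_gauss_ge0.
by rewrite lte_mul_pinfty// integral_exp_lty.
Qed.

Let integrable_even_gauss a p : 0 < a ->
  mu.-integrable setT (EFin \o even_gauss a p).
Proof.
move=> a0; apply/integrableP; split; first by apply/measurable_EFinP; exact: measurable_even_gauss.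
under eq_integral do rewrite /= ger0_norm//.
exact: even_gauss_lty.
Qed.

Let I a p := \int[mu]_x even_gauss a p x.

Let IE a p : 0 < a -> (\int[mu]_x (even_gauss a p x)%:E = (I a p)%:E)%E.
Proof.
move=> a0; rewrite fineK// ge0_fin_numE ?even_gauss_lty//.
by apply: integral_ge0 => x _; rewrite lee_fin even_gauss_ge0.
Qed.

(* Compare the Gaussian with its dilation by [s], using [1 + y <= exp y]. *)
Let I_dilation a p s : 0 < a -> 0 < s ->
  I a p * (s ^+ (2 * p).+1 - 1) <= s ^+ (2 * p).+1 * (s ^+ 2 - 1) * (a * I a p.+1).
Proof.
move=> a0 s0; have ms : measurable_fun setT (fun x => even_gauss a p (0 + s * x)).
  apply: (measurableT_comp (measurable_even_gauss a p)).
  by apply: measurable_funD => //; exact: measurable_funM.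
have sI : (\int[mu]_x (even_gauss a p (0 + s * x))%:E = (s^-1 * I a p)%:E)%E.
  rewrite (@ge0_integral_affine R 0 s (EFin \o even_gauss a p)) ?lt0r_neq0//.
  - by rewrite /= IE// gtr0_norm.
  - by apply/measurable_EFinP; exact: measurable_even_gauss.
  - by move=> x; rewrite lee_fin.
have iS : mu.-integrable setT (EFin \o (fun x => even_gauss a p (0 + s * x))).
  apply/integrableP; split; first exact/measurable_EFinP.
  by under eq_integral do rewrite /= ger0_norm//; rewrite sI ltry.
pose c := s ^+ (2 * p) * (a * (s ^+ 2 - 1)).
have i1 := integrable_even_gauss p a0; have i2 := integrable_even_gauss p.+1 a0.
have i1' : mu.-integrable setT (EFin \o (fun x => s ^+ (2 * p) * even_gauss a p x)).
  by have := integrableZl measurableT (s ^+ (2 * p)) i1.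
have i2' : mu.-integrable setT (EFin \o (fun x => c * even_gauss a p.+1 x)).
  by have := integrableZl measurableT c i2.
have : \int[mu]_x (s ^+ (2 * p) * even_gauss a p x - c * even_gauss a p.+1 x) <=
       \int[mu]_x even_gauss a p (0 + s * x).
  apply: le_Rintegral => //.
    by have := integrableB measurableT i1' i2'.
  move=> x _; rewrite add0r /even_gauss exprMn -[leRHS]mulrA mulnS exprD.
  rewrite (_ : _ - _ = s ^+ (2 * p) * (x ^+ (2 * p) * (expR (- (a * x ^+ 2)) *
    (1 + - (a * (s ^+ 2 - 1) * x ^+ 2))))); last by rewrite /c; ring.
  apply: ler_wpM2l (exprn_ge0 _ (ltW s0)) _ _ _.
  apply: ler_wpM2l; first by rewrite exprM exprn_ge0 ?sqr_ge0.
  rewrite (_ : - (a * (s * x) ^+ 2) = - (a * x ^+ 2) + - (a * (s ^+ 2 - 1) * x ^+ 2)).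
    by rewrite expRD ler_wpM2l ?expR_ge0// expR_ge1Dx.
  by ring.
rewrite RintegralB// !RintegralZl//.
have -> : \int[mu]_x even_gauss a p (0 + s * x) = s^-1 * I a p.
  by rewrite /Rintegral sI.
rewrite -(ler_pM2l s0) mulrA mulfV ?lt0r_neq0// mul1r -/(I a p) -/(I a p.+1).
by rewrite exprS /c; lra.
Qed.

Lemma continuous_ge0_right (f : R -> R) : continuous f ->
  (forall e, 0 < e < 1 -> 0 <= f e) -> 0 <= f 0.
Proof.
move=> cf f0; rewrite leNgt; apply/negP => fneg.
have : \forall x \near (0 : R), f x < 0.
  exact: (cvgr_lt (f 0) (cf 0)).
move=> /nbhs_ballP[e /= e0] /(_ (Num.min e 1 / 2)).
have m0 : 0 < Num.min e 1 by rewrite lt_min e0 ltr01.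
have me : Num.min e 1 <= e by rewrite ge_min lexx.
have m1 : Num.min e 1 <= 1 by rewrite ge_min lexx orbT.
rewrite /ball /= sub0r normrN gtr0_norm ?divr_gt0// => /(_ _)/wrap[]; first lra.
by rewrite ltNge f0//; apply/andP; split; lra.
Qed.

(** Integration by parts in one variable, without derivatives. At [s = 1 + e] in [I_dilation] the
    two sides differ by [e * f e], which is nonnegative for both signs of [e]; continuity then
    forces [f 0] to be both nonnegative and nonpositive. *)
Let I_step a p : 0 < a -> 2 * (a * I a p.+1) = (2 * p).+1%:R * I a p.
Proof.
move=> a0; set b := a * _; set c := I a p; set m := (2 * p).+1.
have h s : 0 < s -> c * (s ^+ m - 1) <= s ^+ m * (s ^+ 2 - 1) * b.
  exact: I_dilation.
pose f e := (1 + e) ^+ m * (2 + e) * b - c * \sum_(i < m) (1 + e) ^+ i.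
have hf e : -1 < e -> 0 <= e * f e.
  move=> e1; have := h (1 + e); rewrite -subr_ge0 => /(_ _)/wrap[]; first lra.
  rewrite (subrX1 _ m) /f; set S := \sum_(i < m) _.
  by move=> /le_trans; apply; rewrite le_eqVlt; apply/orP; left; apply/eqP; ring.
have cf : continuous f.
  have c1 k : continuous (fun e : R => (1 + e) ^+ k).
    move=> x; apply: (@continuous_comp _ _ _ (fun e : R => 1 + e) (fun y : R => y ^+ k)).
      by apply: cvgD; [exact: cvg_cst|exact: cvg_id].
    exact: exprn_continuous.
  move=> x; apply: cvgB.
    apply: cvgM; last exact: cvg_cst.
    by apply: cvgM; [exact: c1|apply: cvgD; [exact: cvg_cst|exact: cvg_id]].
  apply: cvgM; first exact: cvg_cst.
  apply: (@continuous_big _ _ _ _ _ _ R) => [|i _]; first exact: add_continuous.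
  exact: c1.
have f0 : f 0 = 2 * b - c * m%:R.
  rewrite /f !addr0 expr1n mul1r; under eq_bigr do rewrite expr1n.
  by rewrite sumr_const card_ord.
have f1 : 0 <= f 0.
  apply: continuous_ge0_right => // e /andP[e0 e1].
  by rewrite -(pmulr_rge0 _ e0) hf//; lra.
have f2 : 0 <= - f (- 0).
  apply: (@continuous_ge0_right (fun x => - f (- x))).
    move=> x; apply: cvgN; apply: (continuous_comp (g := f)); last exact: cf.
    exact: opp_continuous.
  move=> e /andP[e0 e1]; rewrite -(pmulr_rge0 _ e0) mulrN -mulNr hf//; lra.
rewrite oppr0 in f2.
by apply/eqP; rewrite eq_le; apply/andP; split; lra.
Qed.

Fixpoint gauss_moment (s : R) k {struct k} : R :=
  match k with
  | 0 => 1
  | 1 => 0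
  | k'.+2 => k'.+1%:R * s ^+ 2 * gauss_moment s k'
  end.

Variable s : R.
Hypothesis s0 : 0 < s.
Local Notation gam := (normal_prob 0 s).

Lemma ge0_integral_normal_prob (f : R -> R) :
  measurable_fun setT f -> (forall x, 0 <= f x) ->
  (\int[gam]_x (f x)%:E = \int[mu]_x (f x * normal_pdf 0 s x)%:E)%E.
Proof.
apply: (@ge0_integral_density _ _ R mu gam (normal_pdf 0 s)) => //.
  exact: measurable_normal_pdf.
by move=> x; exact: normal_pdf_ge0.
Qed.

(** The normalising constant is never evaluated: total mass one settles [p = 0], and [I_step]
    reproduces the recursion of [gauss_moment]. *)
Lemma integral_normal_even p :
  (\int[gam]_x (x ^+ (2 * p))%:E = (gauss_moment s (2 * p))%:E)%E.
Proof.
have sn0 : s != 0 by rewrite gt_eqF.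
pose a := (s ^+ 2 *+ 2)^-1; have a0 : 0 < a by rewrite invr_gt0 mulrn_wgt0// exprn_gt0.
have E q : (\int[gam]_x (x ^+ (2 * q))%:E = (normal_peak s * I a q)%:E)%E.
  rewrite (@ge0_integral_normal_prob (fun x => x ^+ (2 * q))); last 2 first.
  - exact: measurable_funX.
  - by move=> x; rewrite exprM exprn_ge0 ?sqr_ge0.
  under eq_integral => x _.
    rewrite normal_pdf_exp// -/a (_ : x ^+ (2 * q) * _ = normal_peak s * even_gauss a q x); last first.
      by rewrite /even_gauss muln0 expr0; ring.
    over.
  under eq_integral do rewrite EFinM.
  rewrite ge0_integralZl ?IE//.
  - by apply/measurable_EFinP; exact: measurable_even_gauss.
  - by move=> x _; rewrite lee_fin even_gauss_ge0.
  - by rewrite lee_fin normal_peak_ge0.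
rewrite E; congr EFin; elim: p => [|p IH].
  have := E 0%N; rewrite muln0.
  under eq_integral do rewrite expr0.
  by rewrite integral_cst//= mul1e probability_setT => -[].
rewrite mulnS /= -IH (mulrCA _ (normal_peak s)); congr (_ * _).
have as2 : a * s ^+ 2 *+ 2 = 1.
  by rewrite -mulrnAr mulVf// mulrn_eq0/= sqrf_eq0.
rewrite (_ : _ * I a p = s ^+ 2 * ((2 * p).+1%:R * I a p)); last by ring.
rewrite -I_step// -[LHS]mul1r -[X in X * _]as2 mulr2n.
by ring.
Qed.

Lemma integrable_normal_exprn k : gam.-integrable setT (EFin \o (fun x => x ^+ k)).
Proof.
have mk j : measurable_fun setT (fun x : R => x ^+ j) by exact: measurable_funX.
apply/integrableP; split; first exact/measurable_EFinP.
apply: (@le_lt_trans _ _ (\int[gam]_x (1 + x ^+ (2 * k))%:E)%E).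
  apply: ge0_le_integral => //.
  - by apply: measurableT_comp => //; exact/measurable_EFinP.
  - by apply/measurable_EFinP; exact: measurable_funD.
  move=> x _; rewrite lee_fin normrX.
  rewrite exprM -(real_normK (num_real x)) -exprM mulnC exprM.
  have := sqr_ge0 (`|x| ^+ k - 1); have := sqr_ge0 (`|x| ^+ k); nra.
under eq_integral do rewrite EFinD.
rewrite ge0_integralD//; last 2 first.
- by move=> x _; rewrite lee_fin exprM exprn_ge0 ?sqr_ge0.
- exact/measurable_EFinP.
by rewrite integral_normal_even integral_cst//= mul1e probability_setT -EFinD ltry.
Qed.

Lemma normal_prob_opp (A : set R) : measurable A -> gam (-%R @^-1` A) = gam A.
Proof.
move=> mA; rewrite /normal_prob integral_mkcond [RHS]integral_mkcond.
have pN x : normal_pdf 0 s (- x) = normal_pdf 0 s x.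
  by rewrite !normal_pdf_exp ?gt_eqF// /even_gauss sqrrN !muln0 !expr0.
pose f := (fun x => (normal_pdf 0 s x)%:E) \_ A.
have f0 x : (0 <= f x)%E.
  by rewrite /f patchE; case: ifPn => // _; rewrite lee_fin normal_pdf_ge0.
have mf : measurable_fun setT f.
  apply/(measurable_restrictT _ mA)/measurable_funTS/measurable_EFinP.
  exact: measurable_normal_pdf.
have N1 : (-1 : R) != 0 by rewrite oppr_eq0 oner_eq0.
have := ge0_integral_affine 0 N1 mf f0; rewrite normrN normr1 invr1 mul1e => <-.
apply: eq_integral => x _; rewrite add0r mulN1r /f !patchE -[in RHS]pN opprK.
by [].
Qed.

Lemma integral_normal_exprn k :
  (\int[gam]_x (x ^+ k)%:E = (gauss_moment s k)%:E)%E.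
Proof.
have [ek|ok] := boolP (odd k); last first.
  by rewrite -[k]odd_double_half (negbTE ok) add0n -mul2n integral_normal_even.
have -> : gauss_moment s k = 0.
  rewrite -[k]odd_double_half ek add1n; elim: (k./2) => // q IH.
  by rewrite doubleS [LHS]/= [X in _ * X]IH mulr0.
pose opp : measurableTypeR R -> measurableTypeR R := -%R.
have mopp : measurable_fun setT opp by apply: measurableT_comp => //; exact: oppr_measurable.
pose nu := measure_function_pushforward__canonical__measure_function_Measure gam mopp.
have ik := integrable_normal_exprn k.
(* The law is symmetric, so an odd moment equals its opposite. *)
have e : (\int[gam]_x (x ^+ k)%:E = - \int[gam]_x (x ^+ k)%:E)%E.
  transitivity (\int[nu]_x (x ^+ k)%:E)%E.
    by apply: eq_measure_integral => A mA _; exact/esym/normal_prob_opp.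
  have ikN : gam.-integrable (opp @^-1` setT) ((EFin \o (fun x => x ^+ k)) \o opp).
    have := integrableN ik; apply: eq_integrable => // x _.
    by rewrite /= /opp exprNn -signr_odd ek expr1 mulN1r.
  transitivity (\int[gam]_x ((opp x : R) ^+ k)%:E)%E.
    by rewrite integral_pushforward//; apply/measurable_EFinP; exact: measurable_funX.
  rewrite -integralN; last by apply: integrable_add_def.
  by apply: eq_integral => x _; rewrite /= /opp exprNn -signr_odd ek expr1 mulN1r.
have /fineK fK := integral_fune_fin_num measurableT ik.
move: e; rewrite -fK -EFinN => -[] e.
by congr EFin; lra.
Qed.

End gaussian_moments.

(** * Gaussian integration by parts in algebraic form *)

Section gaussian_ibp.
Context {R : realType} (n : nat) (s : R).
Hypothesis s0 : 0 < s.
Local Notation gam := (power_measure (normal_prob 0 s) n).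
Implicit Types (F : n.-tuple R -> R) (e : 'I_n -> nat).

Let mon e (t : n.-tuple R) : R := \prod_j tnth t j ^+ e j.
Let inc e (i : 'I_n) := fun j => (e j + (j == i))%N.
(** Subtraction is truncated: if [e i = 0] then [dec e i] is [e]. In [gaussian_ibp] the
    corresponding integral carries the coefficient [(e i)%:R], which vanishes in that case. *)
Let dec e (i : 'I_n) := fun j => (e j - (j == i))%N.

Let mon_inc e i t : mon (inc e i) t = tnth t i * mon e t.
Proof.
rewrite /mon (bigD1 i)//= [in RHS](bigD1 i)//= /inc eqxx addn1 exprS mulrA.
by congr (_ * _); apply: eq_bigr => j /negbTE ->; rewrite addn0.
Qed.

Let mon0 t : mon (fun=> 0%N) t = 1.
Proof. by rewrite /mon big1. Qed.

Let integrable_mon e : gam.-integrable setT (EFin \o mon e).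
Proof.
apply: (@integrable_power_measure_prod _ _ R (normal_prob 0 s) n (fun i x => x ^+ e i)) => i.
exact: integrable_normal_exprn.
Qed.

Let integral_mon e : \int[gam]_t mon e t = \prod_j gauss_moment s (e j).
Proof.
rewrite /Rintegral (@integral_power_measure_prod _ _ R (normal_prob 0 s) n (fun i x => x ^+ e i)
  (fun i => gauss_moment s (e i)))//.
- by move=> i; exact: integrable_normal_exprn.
- by move=> i; exact: integral_normal_exprn.
Qed.

Definition poly_integrable F :=
  forall e, gam.-integrable setT (fun t => (mon e t * F t)%:E).

(* [F'] plays the role of the derivative of [F] in the direction [i]; the
   monomials [mon e] make the relation stable under multiplication by a
   coordinate. *)
Definition gaussian_ibp i F F' := [/\ poly_integrable F, poly_integrable F' &
  forall e, \int[gam]_t (tnth t i * mon e t * F t) =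
    s ^+ 2 * ((e i)%:R * \int[gam]_t (mon (dec e i) t * F t)
              + \int[gam]_t (mon e t * F' t))].

Lemma poly_integrableW F : poly_integrable F -> gam.-integrable setT (EFin \o F).
Proof.
move=> /(_ (fun=> 0%N)); apply: eq_integrable => // t _.
by rewrite mon0 mul1r.
Qed.

Lemma poly_integrable_coord j F :
  poly_integrable F -> poly_integrable (fun t => tnth t j * F t).
Proof.
move=> iF e; apply: eq_integrable (iF (inc e j)) => // t _.
by rewrite mon_inc mulrCA mulrA.
Qed.

Lemma poly_integrableD F1 F2 : poly_integrable F1 -> poly_integrable F2 ->
  poly_integrable (fun t => F1 t + F2 t).
Proof.
move=> i1 i2 e; apply: eq_integrable (integrableD measurableT (i1 e) (i2 e)) => // t _.
by rewrite mulrDr EFinD.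
Qed.

Lemma poly_integrableZ a F : poly_integrable F -> poly_integrable (fun t => a * F t).
Proof.
move=> i1 e; apply: eq_integrable (integrableZl measurableT a (i1 e)) => // t _.
by rewrite mulrCA EFinM.
Qed.

Lemma poly_integrable0 : poly_integrable (fun=> 0).
Proof.
by move=> e; apply: eq_integrable (integrable0 _ _) => // t _; rewrite mulr0.
Qed.

(** Moments of monomials factor over coordinates, and in coordinate [i] the identity is the
    recursion defining [gauss_moment]. *)
Lemma gaussian_ibp1 i : gaussian_ibp i (fun=> 1) (fun=> 0).
Proof.
split; [|exact: poly_integrable0|].
  by move=> e; apply: eq_integrable (integrable_mon e) => // t _; rewrite /= mulr1.
move=> e.
under eq_Rintegral do rewrite mulr1 -mon_inc.
under [X in _ * (_ * X + _)]eq_Rintegral do rewrite mulr1.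
under [X in _ * (_ + X)]eq_Rintegral do rewrite mulr0.
rewrite Rintegral_cst//= mul0r addr0 !integral_mon.
rewrite (bigD1 i)//= [in RHS](bigD1 i)//= /inc /dec !eqxx addn1 !mulrA.
congr (_ * _); last by apply: eq_bigr => j /negbTE ->; rewrite addn0 subn0.
case: (e i) => [|k]; first by rewrite mulr0 mul0r.
by rewrite subn1 /=; ring.
Qed.

(** The new coordinate is absorbed into the monomial. When [i = j] the exponent [e i] rises by one,
    and this extra unit is the additional term of the product rule. *)
Lemma gaussian_ibp_coord i j F F' : gaussian_ibp i F F' ->
  gaussian_ibp i (fun t => tnth t j * F t)
    (fun t => (i == j)%:R * F t + tnth t j * F' t).
Proof.
move=> [iF iF' ibp]; split; first exact: poly_integrable_coord.
  by apply: poly_integrableD; [exact: poly_integrableZ|exact: poly_integrable_coord].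
move=> e.
have e1 : \int[gam]_t (tnth t i * mon e t * (tnth t j * F t)) =
          \int[gam]_t (tnth t i * mon (inc e j) t * F t).
  by apply: eq_Rintegral => t _; rewrite mon_inc; ring.
have e2 : \int[gam]_t (mon (dec e i) t * (tnth t j * F t)) =
          \int[gam]_t (mon (inc (dec e i) j) t * F t).
  by apply: eq_Rintegral => t _; rewrite mon_inc; ring.
have e3 : \int[gam]_t (mon e t * ((i == j)%:R * F t + tnth t j * F' t)) =
    (i == j)%:R * \int[gam]_t (mon e t * F t)
    + \int[gam]_t (mon (inc e j) t * F' t).
  transitivity (\int[gam]_t ((i == j)%:R * (mon e t * F t) + mon (inc e j) t * F' t)).
    by apply: eq_Rintegral => t _; rewrite mon_inc; ring.
  rewrite RintegralD//; [|exact: (integrableZl measurableT _ (iF e))|exact: iF'].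
  by rewrite RintegralZl//; exact: iF.
rewrite e1 ibp e2 e3; congr (_ * _); rewrite addrA; congr (_ + _).
have [<-|ij] := eqVneq i j; last first.
  rewrite mul0r addr0 {1}/inc (negbTE ij) addn0; congr (_ * _).
  apply: eq_Rintegral => t _; congr (mon _ t * _); apply/funext => k.
  rewrite /inc /dec; have [->|] := eqVneq k i; last by rewrite !subn0.
  by rewrite (negbTE ij) !addn0.
have -> : dec (inc e i) i = e by apply/funext => k; rewrite /dec /inc addnK.
rewrite {1}/inc eqxx addn1 -natr1 mulrDl !mul1r; congr (_ + _).
have [->|ei] := eqVneq (e i) 0%N; first by rewrite !mul0r.
congr (_ * _); apply: eq_Rintegral => t _; congr (mon _ t * _); apply/funext => k.
by rewrite /inc /dec; have [->|_] := eqVneq k i; rewrite ?subn0 ?addn0// subnK// lt0n.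
Qed.

Lemma gaussian_ibpD i F1 F1' F2 F2' : gaussian_ibp i F1 F1' -> gaussian_ibp i F2 F2' ->
  gaussian_ibp i (fun t => F1 t + F2 t) (fun t => F1' t + F2' t).
Proof.
move=> [i1 i1' h1] [i2 i2' h2]; split; [exact: poly_integrableD|exact: poly_integrableD|].
move=> e.
under eq_Rintegral do rewrite mulrDr.
under [X in _ * (_ * X + _)]eq_Rintegral do rewrite mulrDr.
under [X in _ * (_ + X)]eq_Rintegral do rewrite mulrDr.
have j1 : gam.-integrable setT (fun t => (tnth t i * mon e t * F1 t)%:E).
  by have := i1 (inc e i); apply: eq_integrable => // t _; rewrite mon_inc.
have j2 : gam.-integrable setT (fun t => (tnth t i * mon e t * F2 t)%:E).
  by have := i2 (inc e i); apply: eq_integrable => // t _; rewrite mon_inc.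
rewrite (RintegralD measurableT j1 j2) (RintegralD measurableT (i1 _) (i2 _)).
rewrite (RintegralD measurableT (i1' e) (i2' e)) h1 h2.
by ring.
Qed.

Lemma gaussian_ibpZ i a F F' : gaussian_ibp i F F' ->
  gaussian_ibp i (fun t => a * F t) (fun t => a * F' t).
Proof.
move=> [i1 i1' h1]; split; [exact: poly_integrableZ|exact: poly_integrableZ|].
move=> e.
under eq_Rintegral do rewrite mulrCA.
under [X in _ * (_ * X + _)]eq_Rintegral do rewrite mulrCA.
under [X in _ * (_ + X)]eq_Rintegral do rewrite mulrCA.
have j1 : gam.-integrable setT (fun t => (tnth t i * mon e t * F t)%:E).
  by have := i1 (inc e i); apply: eq_integrable => // t _; rewrite mon_inc.
rewrite (RintegralZl a measurableT j1) (RintegralZl a measurableT (i1 _)).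
rewrite (RintegralZl a measurableT (i1' e)) h1.
by ring.
Qed.

Lemma gaussian_ibp0 i : gaussian_ibp i (fun=> 0) (fun=> 0).
Proof.
have e x : (fun _ : n.-tuple R => 0 * x) = fun=> 0 :> R.
  by apply/funext => t; rewrite mul0r.
by have := gaussian_ibpZ 0 (gaussian_ibp1 i); rewrite !e.
Qed.

Lemma gaussian_ibp_sum i (I : Type) (r : seq I) (F F' : I -> n.-tuple R -> R) :
  (forall k, gaussian_ibp i (F k) (F' k)) ->
  gaussian_ibp i (fun t => \sum_(k <- r) F k t) (fun t => \sum_(k <- r) F' k t).
Proof.
move=> h; elim: r => [|k r IH].
  have e (G : I -> n.-tuple R -> R) : (fun t => \sum_(k <- [::]) G k t) = fun=> 0.
    by apply/funext => t; rewrite big_nil.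
  by rewrite !e; exact: gaussian_ibp0.
have e (G : I -> n.-tuple R -> R) : (fun t => \sum_(k <- k :: r) G k t) =
    fun t => G k t + \sum_(k <- r) G k t.
  by apply/funext => t; rewrite big_cons.
by rewrite !e; exact: gaussian_ibpD.
Qed.

Lemma gaussian_ibpE i F F' : gaussian_ibp i F F' ->
  \int[gam]_t (tnth t i * F t) = s ^+ 2 * \int[gam]_t F' t.
Proof.
move=> [_ _ /(_ (fun=> 0%N))]; rewrite mul0r add0r.
under eq_Rintegral do rewrite mon0 mulr1.
by under [X in _ * X]eq_Rintegral do rewrite mon0 mul1r.
Qed.

End gaussian_ibp.

Lemma power_normal_prob_setT (R : realType) (s : R) n :
  power_measure (normal_prob 0 s) n setT = 1%E.
Proof.
transitivity (\int[power_measure (normal_prob 0 s) n]_t (\prod_(i < n) 1)%:E)%E.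
  by under eq_integral do rewrite big1_eq; rewrite integral_cst// mul1e.
rewrite (@ge0_integral_power_measure_prod _ _ R (normal_prob 0 s) n
  (fun _ _ => 1) (fun _ => 1)) ?big1_eq// => i.
by rewrite integral_cst// mul1e; exact: probability_setT.
Qed.

Lemma Rintegral_sum (R : realType) d (T : measurableType d) (mu : {measure set T -> \bar R})
    (I : Type) (r : seq I) (F : I -> T -> R) :
  (forall i, mu.-integrable setT (EFin \o F i)) ->
  \int[mu]_x (\sum_(i <- r) F i x) = \sum_(i <- r) \int[mu]_x F i x.
Proof.
move=> iF; have iS r' : mu.-integrable setT (EFin \o (fun x => \sum_(i <- r') F i x)).
  have := @integrable_sum _ _ _ mu setT measurableT I r' xpredT (fun i => EFin \o F i) (fun i _ => iF i).
  by apply: eq_integrable => // x _; rewrite /= sumEFin.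
elim: r => [|i r IH].
  under eq_Rintegral do rewrite big_nil.
  by rewrite big_nil Rintegral_cst// mul0r.
under eq_Rintegral do rewrite big_cons.
by rewrite RintegralD// big_cons IH.
Qed.

(** * Moments of a Gaussian series with symmetric coefficients *)

Section gaussian_series.
Context {R : realType} (n k : nat) (s v : R) (A : 'I_n -> 'M[R]_k).
Hypotheses (n0 : (0 < n)%N) (s0 : 0 < s).
Hypothesis AT : forall i, (A i)^T = A i.
Hypothesis Av : forall w : 'cV[R]_k,
  mxdot w ((\sum_i A i *m A i) *m w) <= v * mxdot w w.
Local Notation gam := (power_measure (normal_prob 0 s) n).

Definition matrix_series (t : n.-tuple R) : 'M[R]_k := \sum_i tnth t i *: A i.
Local Notation G := matrix_series.

Let GT t : (G t)^T = G t.
Proof. by rewrite /G linear_sum; apply: eq_bigr => i _; rewrite linearZ /= AT. Qed.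

(** The derivative of [G t ^+ q] in coordinate [i], by the noncommutative Leibniz rule. *)
Let D i q t : 'M[R]_k := \sum_(r < q) G t ^+ r *m A i *m G t ^+ (q.-1 - r).

Let DS i q t : D i q.+1 t = A i *m G t ^+ q + G t *m D i q t.
Proof.
rewrite /D big_ord_recl expr0 mul1mx subn0 mulmx_sumr; congr (_ + _).
apply: eq_bigr => r _; rewrite lift0 exprS -[G t * _]/(G t *m _) !mulmxA.
by congr (_ *m _ ^+ _); lia.
Qed.

Let GS q t a b : (G t ^+ q.+1) a b =
  \sum_c \sum_j A j a c * (tnth t j * (G t ^+ q) c b).
Proof.
rewrite exprS -[_ * _]/(_ *m _) mxE; apply: eq_bigr => c _.
rewrite /G summxE mulr_suml; apply: eq_bigr => j _; rewrite mxE.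
by rewrite mulrA (mulrC (A j a c)).
Qed.

(** Entrywise, a power is a linear combination of coordinates times entries of the previous power
    ([GS]), so the scalar rule [gaussian_ibp_coord] drives the induction. *)
Let ibp_exp i q a b :
  gaussian_ibp s i (fun t => (G t ^+ q) a b) (fun t => D i q t a b).
Proof.
elim: q a b => [|q IH] a b.
  have := gaussian_ibpZ ((1%:M : 'M[R]_k) a b) (gaussian_ibp1 s0 i).
  under eq_fun do rewrite mulr1.
  have -> : (fun t => D i 0 t a b) = fun=> (1%:M : 'M[R]_k) a b * 0.
    by apply/funext => t; rewrite /D big_ord0 mxE mulr0.
  by [].
have -> : (fun t => (G t ^+ q.+1) a b) = fun t =>
    \sum_c \sum_j A j a c * (tnth t j * (G t ^+ q) c b).
  by apply/funext => t; exact: GS.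
have -> : (fun t => D i q.+1 t a b) = fun t =>
    \sum_c \sum_j A j a c * ((i == j)%:R * (G t ^+ q) c b + tnth t j * D i q t c b).
  apply/funext => t; rewrite DS !mxE -big_split /=; apply: eq_bigr => c _.
  under [RHS]eq_bigr do rewrite mulrDr.
  rewrite big_split /=; congr (_ + _).
    rewrite (bigD1 i)//= eqxx mul1r big1 ?addr0// => j ji.
    by rewrite eq_sym (negbTE ji) mul0r mulr0.
  rewrite /G summxE mulr_suml; apply: eq_bigr => j _.
  by rewrite mxE mulrA (mulrC (A j a c)).
apply: gaussian_ibp_sum => // c; apply: gaussian_ibp_sum => // j.
by apply: gaussian_ibpZ => //; exact: gaussian_ibp_coord.
Qed.

Let ibp_tr i (M : 'M[R]_k) q :
  gaussian_ibp s i (fun t => \tr (M *m G t ^+ q)) (fun t => \tr (M *m D i q t)).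
Proof.
have e (N : n.-tuple R -> 'M[R]_k) :
    (fun t => \tr (M *m N t)) = fun t => \sum_a \sum_b M a b * N t b a.
  by apply/funext => t; apply: eq_bigr => a _; rewrite mxE.
rewrite !e; apply: gaussian_ibp_sum => // a; apply: gaussian_ibp_sum => // b.
exact: gaussian_ibpZ.
Qed.

Let integrable_tr (M : 'M[R]_k) q :
  gam.-integrable setT (EFin \o (fun t => \tr (M *m G t ^+ q))).
Proof. by have [i _ _] := ibp_tr (Ordinal n0) M q; exact: poly_integrableW i. Qed.

Lemma integrable_mxtrace_series q :
  gam.-integrable setT (EFin \o (fun t => \tr (G t ^+ q))).
Proof.
by apply: eq_integrable (integrable_tr 1%:M q) => // t _; rewrite /= mul1mx.
Qed.

(** Expand one factor [G], integrate by parts in each coordinate, and bound each of the [(r + r).+1]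
    Leibniz terms by [mxtrace_sandwich_le]. All squares [A i *m A i] then sit side by side, and
    their sum is controlled by [v]. *)
Let moment_step r :
  \int[gam]_t \tr (G t ^+ (r.+1 + r.+1)) <=
  s ^+ 2 * ((r + r).+1%:R * (v * \int[gam]_t \tr (G t ^+ (r + r)))).
Proof.
have trE t : \tr (G t ^+ (r.+1 + r.+1)) =
    \sum_i tnth t i * \tr (A i *m G t ^+ (r + r).+1).
  rewrite addSn addnS exprS -[_ * _]/(_ *m _) {1}/G mulmx_suml raddf_sum /=.
  by apply: eq_bigr => i _; rewrite -scalemxAl mxtraceZ.
under eq_Rintegral do rewrite trE.
rewrite Rintegral_sum; last first.
  move=> i; have [iF _ _] := ibp_tr i (A i) (r + r).+1.
  by have := poly_integrableW (poly_integrable_coord i iF).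
have step i : \int[gam]_t (tnth t i * \tr (A i *m G t ^+ (r + r).+1)) <=
    s ^+ 2 * ((r + r).+1%:R * \int[gam]_t \tr (A i *m A i *m G t ^+ (r + r))).
  have ibpi := ibp_tr i (A i) (r + r).+1.
  rewrite (gaussian_ibpE ibpi) ler_wpM2l ?sqr_ge0// -RintegralZl//.
  apply: le_Rintegral => //.
  - by have [_ iD _] := ibpi; exact: poly_integrableW iD.
  - exact: (integrableZl measurableT _ (integrable_tr _ _)).
  move=> t _; rewrite /D mulmx_sumr raddf_sum /=.
  rewrite -[X in X%:R * _]card_ord mulr_natl -sumr_const ler_sum// => q _.
  by rewrite !mulmxA; apply: mxtrace_sandwich_le => //; rewrite -ltnS.
apply: le_trans (ler_sum _ (fun i _ => step i)) _.
rewrite -mulr_sumr ler_wpM2l ?sqr_ge0// -mulr_sumr ler_wpM2l//.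
rewrite -Rintegral_sum => [|i]; last exact: integrable_tr.
rewrite -RintegralZl//; last exact: integrable_mxtrace_series.
apply: le_Rintegral => //.
- have := integrable_tr (\sum_i A i *m A i) (r + r); apply: eq_integrable => // t _.
  by congr EFin; rewrite mulmx_suml raddf_sum.
- exact: (integrableZl measurableT _ (integrable_mxtrace_series _)).
move=> t _; rewrite -raddf_sum -mulmx_suml /= -mulmx_exp mulmxA mxtrace_mulC.
rewrite -{1}(trmx_exp r (GT t)) -[X in _ <= _ * \tr (X *m _)](trmx_exp r (GT t)).
exact: mxtrace_mul_le Av.
Qed.

Lemma gaussian_series_moment r : 0 <= v ->
  (\int[gam]_t \tr (G t ^+ (r + r))) / (r + r)`!%:R <=
  k%:R * ((s ^+ 2 * v / 2) ^+ r / r`!%:R).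
Proof.
move=> v0; elim: r => [|r IH].
  under eq_Rintegral do rewrite expr0 mxtrace1.
  by rewrite Rintegral_cst//= power_normal_prob_setT fact0 expr0 !divr1 !mulr1.
rewrite ler_pdivrMr ?ltr0n ?fact_gt0// (le_trans (moment_step r))//.
move: IH; rewrite ler_pdivrMr ?ltr0n ?fact_gt0// => IH.
set m := \int[gam]_t _ in IH *; set N : R := (r + r)`!%:R in IH *.
have N0 : 0 < N by rewrite ltr0n fact_gt0.
have r0 : r`!%:R != 0 :> R by rewrite pnatr_eq0 -lt0n fact_gt0.
have c0 : 0 <= s ^+ 2 * (r + r).+1%:R * v by apply: mulr_ge0 => //; apply: mulr_ge0 => //; exact: sqr_ge0.
rewrite (_ : s ^+ 2 * _ = s ^+ 2 * (r + r).+1%:R * v * m); last by ring.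
rewrite (le_trans (ler_wpM2l c0 IH))// addSn addnS !factS (exprS _ r) !natrM -/N.
rewrite le_eqVlt; apply/orP; left; apply/eqP.
have -> : (r + r).+2%:R = 2 * r.+1%:R :> R by rewrite -natrM; congr (_%:R); lia.
by field; rewrite r0 /= addrC natr1 pnatr_eq0.
Qed.

End gaussian_series.

Section exponential_series.
Context {R : realType}.

Lemma sum_exp_coeff_le (y : R) N : 0 <= y ->
  \sum_(p < N) y ^+ p / p`!%:R <= expR y.
Proof.
move=> y0; rewrite -(big_mkord xpredT (fun p => y ^+ p / p`!%:R)).
have := @nondecreasing_cvgn_le R (series (exp_coeff y)).
move=> /(_ _ (is_cvg_series_exp_coeff y) N); apply.
by apply: nondecreasing_series => k _ _; exact: exp_coeff_ge0.
Qed.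

(** Twice cosh exceeds exp strictly, so a partial sum already does. The Chernoff bound thus needs
    finitely many moments and no exchange of series and integral. *)
Lemma sum_cosh_coeff_ge (x : R) :
  exists N, expR x <= 2 * \sum_(p < N) x ^+ (2 * p) / (p + p)`!%:R.
Proof.
have cv (z : R) : series (exp_coeff z) m @[m --> \oo] --> expR z.
  exact: is_cvg_series_exp_coeff.
have evenE N : series (exp_coeff x) (N + N)%N + series (exp_coeff (- x)) (N + N)%N =
    2 * \sum_(p < N) x ^+ (2 * p) / (p + p)`!%:R.
  elim: N => [|N IH].
    by rewrite big_ord0 mulr0 /series /= !big_geq// addr0.
  rewrite big_ord_recr /= mulrDr -IH addSn addnS /series /= !big_nat_recr//=.
  rewrite /exp_coeff /= addnn -mul2n !exprS !(exprM (- x)) sqrrN -!exprM.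
  by rewrite !mulNr; lra.
have c2 : (series (exp_coeff x) m + series (exp_coeff (- x)) m) @[m --> \oo]
    --> expR x + expR (- x) by exact: cvgD.
have lt : expR x < expR x + expR (- x) by rewrite ltrDl expR_gt0.
have [N _ HN] := cvgr_ge _ c2 _ lt.
by exists N; rewrite -evenE; apply: HN; exact: leq_addr.
Qed.

End exponential_series.

(** * Tail of a Gaussian series with rectangular coefficients *)

Section gaussian_tail.
Context {R : realType} (n m1 m2 : nat) (s w : R) (X : 'I_n -> 'M[R]_(m1, m2)).
Hypotheses (n0 : (0 < n)%N) (s0 : 0 < s) (w0 : 0 < w).
Hypothesis Xw1 : opnorm (n%:R^-1 *: \sum_i X i *m (X i)^T) <= w ^+ 2.
Hypothesis Xw2 : opnorm (n%:R^-1 *: \sum_i (X i)^T *m X i) <= w ^+ 2.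
Local Notation gam := (power_measure (normal_prob 0 s) n).

Let A i := dilation (X i).
Let v := n%:R * w ^+ 2.

Let v0 : 0 < v. Proof. by rewrite mulr_gt0 ?ltr0n ?exprn_gt0. Qed.

Let quadratic_le k (M : 'M[R]_k) (c : 'cV[R]_k) : M^T = M ->
  opnorm (n%:R^-1 *: M) <= w ^+ 2 -> mxdot c (M *m c) <= v * mxdot c c.
Proof.
move=> MT Mw; have nr : 0 < n%:R :> R by rewrite ltr0n.
have := @opnorm_quadratic R _ (n%:R^-1 *: M) c.
rewrite linearZ /= MT => /(_ erefl).
rewrite -scalemxAl mxdotZr ler_pdivrMl// => /le_trans; apply.
by rewrite -mulrA ler_pM2l// ler_wpM2r// mxdot_ge0.
Qed.

(** The square of a dilation is block diagonal, with one block for each of the two matrices in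
    [design_const]; this is why a maximum appears there. *)
Let Av (c : 'cV[R]_(m1 + m2)) :
  mxdot c ((\sum_i A i *m A i) *m c) <= v * mxdot c c.
Proof.
have -> : \sum_i A i *m A i =
    block_mx (\sum_i X i *m (X i)^T) 0 0 (\sum_i (X i)^T *m X i).
  have e i : A i *m A i = block_mx (X i *m (X i)^T) 0 0 ((X i)^T *m X i).
    by rewrite /A /dilation mulmx_block !(mulmx0, mul0mx) !addr0 !add0r.
  under eq_bigr do rewrite e.
  elim/big_rec3: _ => [|i M1 M2 M3 _ ->]; first by rewrite block_mx0.
  by rewrite add_block_mx !addr0.
rewrite -(vsubmxK c) mul_block_col !mul0mx addr0 add0r !mxdot_col_mx mulrDr lerD//.
  apply: quadratic_le => //; rewrite linear_sum; apply: eq_bigr => i _.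
  by rewrite /= trmx_mul trmxK.
apply: quadratic_le => //; rewrite linear_sum; apply: eq_bigr => i _.
by rewrite /= trmx_mul trmxK.
Qed.

Let seriesE t : matrix_series A t = dilation (\sum_i tnth t i *: X i).
Proof.
rewrite /matrix_series; elim/big_rec2: _ => [|i M1 M2 _ ->].
  by rewrite /dilation trmx0 block_mx0.
rewrite /A /dilation scale_block_mx add_block_mx !scaler0 !addr0.
by rewrite linearD linearZ.
Qed.

(** The event is a sublevel set of [S], the truncated cosh trace, hence measurable. If the operator
    bound fails at [x], [mxtrace_dilation_ge] applied term by term gives [K <= S x], so Markov's
    inequality for [S] suffices. *)
Lemma gaussian_series_tail (t : R) : 0 < t ->
  exists2 E : set (n.-tuple R), measurable E &
    ((1 - (m1 + m2)%:R * expR (- (t ^+ 2 / (2 * s ^+ 2 * v))))%:E <= gam E)%E /\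
    forall x, E x -> bilinear_le t (\sum_i tnth x i *: X i).
Proof.
(* The minimiser of the Chernoff exponent [th ^+ 2 * (s ^+ 2 * v / 2) - th * t]. *)
move=> t0; pose th := t / (s ^+ 2 * v).
have sv0 : 0 < s ^+ 2 * v by rewrite mulr_gt0// exprn_gt0.
have th0 : 0 < th by rewrite divr_gt0.
have [N KN] := sum_cosh_coeff_ge (th * t).
set K := 2 * _ in KN.
pose S (x : n.-tuple R) : R :=
  \sum_(p < N) th ^+ (2 * p) / (p + p)`!%:R * \tr (matrix_series A x ^+ (p + p)).
have AT i : (A i)^T = A i by exact: trmx_dilation.
have itr p := @integrable_mxtrace_series R n (m1 + m2) s A n0 s0 p.
have iterm p : gam.-integrable setT (EFin \o (fun x => th ^+ (2 * p) / (p + p)`!%:R *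
    \tr (matrix_series A x ^+ (p + p)))).
  by have := integrableZl measurableT (th ^+ (2 * p) / (p + p)`!%:R) (itr (p + p)%N).
have iS : gam.-integrable setT (EFin \o S).
  have := @integrable_sum _ _ _ gam setT measurableT _ (index_enum 'I_N) xpredT
    (fun p : 'I_N => EFin \o (fun x => th ^+ (2 * p) / (p + p)`!%:R *
    \tr (matrix_series A x ^+ (p + p)))) (fun p _ => iterm p).
  by apply: eq_integrable => // x _; rewrite /= sumEFin.
have mS : measurable_fun setT S by apply/measurable_EFinP; exact: measurable_int iS.
have GT x : (matrix_series A x)^T = matrix_series A x.
  by rewrite seriesE trmx_dilation.
have tr_ge0 p x : 0 <= \tr (matrix_series A x ^+ (p + p)).
  rewrite -mulmx_exp -{1}(trmx_exp p (GT x)); exact: mxdot_ge0.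
have S0 x : 0 <= S x.
  by apply: sumr_ge0 => p _; rewrite mulr_ge0// divr_ge0// exprn_ge0// ltW.
have ES : \int[gam]_x S x <= (m1 + m2)%:R * expR (th ^+ 2 * (s ^+ 2 * v / 2)).
  rewrite Rintegral_sum; last by move=> p; exact: iterm.
  have thv : 0 <= th ^+ 2 * (s ^+ 2 * v / 2).
    by apply: mulr_ge0; [exact: sqr_ge0|apply: divr_ge0 => //; exact: ltW].
  apply: le_trans (ler_wpM2l _ (sum_exp_coeff_le N thv)) => //.
  rewrite mulr_sumr ler_sum// => p _.
  rewrite RintegralZl//.
  have h := gaussian_series_moment n0 s0 AT Av p (ltW v0).
  rewrite -(ler_pM2l (exprn_gt0 (2 * p) th0)) in h.
  rewrite mulrAC -mulrA (le_trans h)// [in leRHS]exprMn -exprM.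
  by rewrite le_eqVlt; apply/orP; left; apply/eqP; ring.
pose E := [set x | S x < K].
have mE : measurable E.
  have -> : E = setT `&` S @^-1` `]-oo, K[.
    by rewrite setTI; apply/seteqP; split => x /=; rewrite in_itv.
  exact: mS.
have K0 : 0 < K by exact: lt_le_trans (expR_gt0 _) KN.
exists E => //; split; last first.
  move=> x Ex; apply: contrapT => /(mxtrace_dilation_ge _ t0) H.
  move: Ex; rewrite /E /= ltNge => /negP; apply.
  rewrite /K /S mulr_sumr ler_sum// => p _.
  rewrite (_ : 2 * _ = th ^+ (2 * p) / (p + p)`!%:R * (2 * t ^+ (2 * p))).
    by rewrite ler_wpM2l ?seriesE// divr_ge0// exprn_ge0// ltW.
  by rewrite exprMn; ring.
have markov : (K%:E * gam (~` E) <= (\int[gam]_x S x)%:E)%E.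
  have mEC := measurableC mE.
  rewrite -(integral_cst gam mEC) integral_mkcond.
  have -> : (\int[gam]_x S x)%:E = (\int[gam]_x (S x)%:E)%E.
    by rewrite fineK//; exact: integrable_fin_num iS.
  apply: ge0_le_integral => //.
  - by move=> x _; rewrite patchE; case: ifPn => // _; rewrite lee_fin ltW.
  - by apply/(measurable_restrictT _ (measurableC mE)); exact: measurable_cst.
  - exact/measurable_EFinP.
  move=> x _; rewrite patchE; case: ifPn; last by rewrite lee_fin.
  by rewrite inE /E /= lee_fin => /negP; rewrite -leNgt.
have gE : (gam E + gam (~` E) = 1)%E.
  rewrite -measureU//; first by rewrite setUv; exact: power_normal_prob_setT.
    exact: measurableC.
  exact: setICr.
have gC : (gam (~` E) <= ((m1 + m2)%:R * expR (- (t ^+ 2 / (2 * s ^+ 2 * v))))%:E)%E.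
  rewrite -(@lee_pmul2l _ K%:E) ?lte_fin// (le_trans markov)// -EFinM lee_fin.
  rewrite (le_trans ES)// [leRHS]mulrCA ler_wpM2l//.
  rewrite (_ : th ^+ 2 * _ = th * t - t ^+ 2 / (2 * s ^+ 2 * v)).
    by rewrite expRD ler_wpM2r ?expR_ge0.
  by rewrite /th; field; rewrite !gt_eqF ?exprn_gt0.
rewrite EFinB leeBlDr//.
by rewrite -gE leeD2l.
Qed.

End gaussian_tail.

(** * The exponentially weighted aggregate *)

Section tuple_functions.
Context {R : realType}.
Local Notation mu := (@lebesgue_measure R).

(** A strict sublevel set is the countable union, over rational centres, of the sets where the
    Lipschitz upper bound from that centre is below the level. Used for the nuclear norm, whose
    definition through polynomial roots does not display measurability. *)
Lemma measurable_tuple_lipschitz N (f : N.-tuple R -> R) :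
  (forall t u, f t - f u <= \sum_k `|tnth t k - tnth u k|) ->
  measurable_fun setT f.
Proof.
move=> lipf _; apply: (measurability _ (RGenInftyO.measurableE R)) => //.
move=> _ [_ [r ->] <-]; rewrite setTI.
pose q (a : N.-tuple rat) : N.-tuple R := [tuple ratr (tnth a k) | k < N].
have -> : f @^-1` `]-oo, r[ = \bigcup_(a in [set: N.-tuple rat])
    [set t | f (q a) + \sum_k `|tnth t k - tnth (q a) k| < r].
  apply/seteqP; split => [t /=|t [a _ /=]]; rewrite in_itv /=.
    (* The Lipschitz error is paid twice, in moving to the centre and back, and [2 * (N%:R * e)]
       must stay strictly below the gap; [N.+1] also covers [N = 0]. *)
    move=> ftr; pose e := (r - f t) / (2 * N.+1%:R).
    have N0 : 0 < 2 * N.+1%:R :> R by rewrite mulr_gt0.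
    have e0 : 0 < e by rewrite divr_gt0 ?subr_gt0.
    have [a Ha] : exists a : N.-tuple rat, forall k, `|tnth t k - ratr (tnth a k)| < e.
      have H k : exists b : rat, `|tnth t k - ratr b| < e.
        have : tnth t k - e < tnth t k + e by lra.
        move=> /rat_in_itvoo[b]; rewrite in_itv /= => /andP[b1 b2].
        by exists b; rewrite ltr_norml; apply/andP; split; lra.
      have [g Hg] := choice H.
      by exists [tuple g k | k < N] => k; rewrite tnth_mktuple.
    exists a => //=; have qa k : tnth (q a) k = ratr (tnth a k) by rewrite tnth_mktuple.
    have S1 : \sum_k `|tnth t k - tnth (q a) k| <= N%:R * e.
      rewrite mulr_natl -[X in _ *+ X]card_ord -sumr_const ler_sum// => k _.
      by rewrite qa ltW.
    have S2 : f (q a) - f t <= \sum_k `|tnth t k - tnth (q a) k|.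
      by rewrite (le_trans (lipf _ _))// ler_sum// => k _; rewrite distrC.
    have : 2 * (N%:R * e) < r - f t.
      rewrite /e mulrA mulrCA mulrA -mulrA gtr_pMr ?subr_gt0//.
      by rewrite ltr_pdivrMr// mul1r ltr_pM2l// ltr_nat.
    by lra.
  by have := lipf t (q a); lra.
apply: countable_bigcupT_measurable => // a.
have mg : measurable_fun setT
    (fun t : N.-tuple R => f (q a) + \sum_k `|tnth t k - tnth (q a) k|).
  apply: measurable_funD => //; apply: measurable_sum => k.
  apply: measurableT_comp => //; apply: measurable_funB => //.
  exact: measurable_tnth.
have := mg measurableT `]-oo, r[%classic (measurable_itv _); rewrite setTI.
by congr measurable; apply/seteqP; split => t /=; rewrite in_itv.
Qed.

Lemma measurable_affine (a c : R) : measurable_fun setT (fun x : R => a + c * x).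
Proof. by apply: measurable_funD => //; exact: measurable_funM. Qed.

(** Dominated by an exponential density plus its reflection, rescaled by [b^-1]. *)
Lemma integrable_exp_abs (b : R) : 0 < b ->
  mu.-integrable setT (EFin \o (fun x => expR (- (b * `|x|)))).
Proof.
move=> b0; have mabs : measurable_fun setT (fun x : R => expR (- (b * `|x|))).
  apply: measurableT_comp => //; apply: measurableT_comp => //.
  by apply: measurable_funM => //; exact: measurableT_comp.
have mpdf := measurable_exponential_pdf b.
have pdf0 x : 0 <= exponential_pdf b x by apply: exponential_pdf_ge0; exact: ltW.
have mpdfN : measurable_fun setT (fun x : R => exponential_pdf b (0 + -1 * x)).
  by apply: (measurableT_comp mpdf); exact: (measurable_affine 0 (-1)).
have N1 : (-1 : R) != 0 by rewrite oppr_eq0 oner_eq0.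
have pdf1 := integral_exponential_pdf b0.
have pdfN1 : (\int[mu]_x (exponential_pdf b (0 + -1 * x)%R)%:E = 1)%E.
  have := @ge0_integral_affine R 0 (-1) (EFin \o exponential_pdf b) N1.
  rewrite normrN normr1 invr1 mul1e => -> //.
  - exact/measurable_EFinP.
apply/integrableP; split; first exact/measurable_EFinP.
apply: (@le_lt_trans _ _ (\int[mu]_x (b^-1%:E *
    (exponential_pdf b x + exponential_pdf b (0 + -1 * x)%R)%:E))%E).
  apply: ge0_le_integral => //.
  - by apply: measurableT_comp => //; exact/measurable_EFinP.
  - by apply: emeasurable_funM => //; apply/measurable_EFinP; exact: measurable_funD.
  move=> x _; rewrite -EFinM lee_fin /= ger0_norm ?expR_ge0// add0r mulN1r.
  rewrite ler_pdivlMl//.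
  have [x0|x0] := leP 0 x.
    by rewrite exponential_pdfE// mulNr ger0_norm// lerDl pdf0.
  have xN : 0 <= - x by rewrite oppr_ge0 ltW.
  rewrite addrC (exponential_pdfE _ xN) mulNr ltr0_norm//.
  by rewrite lerDl pdf0.
rewrite ge0_integralZl//; last 3 first.
- by apply/measurable_EFinP; exact: measurable_funD.
- by move=> x _; rewrite lee_fin addr_ge0.
- by rewrite lee_fin invr_ge0 ltW.
under eq_integral do rewrite EFinD.
rewrite ge0_integralD//; last 4 first.
- by move=> x _; rewrite lee_fin.
- exact/measurable_EFinP.
- by move=> x _; rewrite lee_fin.
- exact/measurable_EFinP.
by rewrite pdf1 pdfN1 -EFinD -EFinM ltry.
Qed.

Lemma integrable_exp_sum_abs N (b : R) : 0 < b ->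
  (power_measure mu N).-integrable setT
    (EFin \o (fun t : N.-tuple R => expR (- (b * \sum_k `|tnth t k|)))).
Proof.
move=> b0; have := @integrable_power_measure_prod _ _ R mu N
  (fun _ x => expR (- (b * `|x|))) (fun _ => integrable_exp_abs b0).
apply: eq_integrable => // t _; rewrite /= mulr_sumr -sumrN expR_sum.
by [].
Qed.

End tuple_functions.

Section tuple_matrix.
Context {R : realType} (m1 m2 : nat).
Local Notation N := (m1 * m2)%N.
Local Notation mx := (@mx_of_tuple R m1 m2).

Definition tuple_norm1 n (t : n.-tuple R) : R := \sum_k `|tnth t k|.

Lemma tuple_norm1_ge0 n (t : n.-tuple R) : 0 <= tuple_norm1 t.
Proof. by apply: sumr_ge0. Qed.

Lemma mx_of_tupleE t i j : mx t i j = tnth t (mxvec_index i j).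
Proof. by rewrite /mx_of_tuple !mxE. Qed.

Lemma mx_of_tuple_sum (f : R -> R) t :
  \sum_i \sum_j f (mx t i j) = \sum_k f (tnth t k).
Proof.
rewrite pair_bigA /= [RHS](reindex _ (curry_mxvec_bij _ _)) /=.
by apply: eq_bigr => -[i j] _; rewrite mx_of_tupleE.
Qed.

Lemma mx_of_tuple_affine (B : 'M[R]_(m1, m2)) (s : R) t :
  mx (affine_tuple (fun k => (1 - s) * mxvec B 0 k) s t) = (1 - s) *: B + s *: mx t.
Proof.
apply/matrixP => i j.
rewrite mx_of_tupleE tnth_mktuple mxvecE -mx_of_tupleE.
by rewrite [RHS]mxE [X in _ = X + _]mxE [X in _ = _ + X]mxE.
Qed.

Lemma measurable_mxdot (A : 'M[R]_(m1, m2)) :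
  measurable_fun setT (fun t => mxdot A (mx t)).
Proof.
under eq_fun do rewrite mxdotE.
apply: measurable_sum => i; apply: measurable_sum => j.
apply: measurable_funM => //; under eq_fun do rewrite mx_of_tupleE.
exact: measurable_tnth.
Qed.

Lemma normr_mxdot_le (A : 'M[R]_(m1, m2)) t :
  `|mxdot A (mx t)| <= (\sum_i \sum_j `|A i j|) * tuple_norm1 t.
Proof.
rewrite mxdotE mulr_suml (le_trans (ler_norm_sum _ _ _))// ler_sum// => i _.
rewrite mulr_suml (le_trans (ler_norm_sum _ _ _))// ler_sum// => j _.
rewrite normrM ler_wpM2l// mx_of_tupleE /tuple_norm1 (bigD1 (mxvec_index i j))//=.
by rewrite lerDl sumr_ge0.
Qed.

Hypothesis svdP : forall B : 'M[R]_(m1, m2),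
  exists r (V1 : 'M[R]_(m1, r)) s (V2 : 'M[R]_(m2, r)), is_svd B V1 s V2.

Lemma nuclear_norm_le_norm1 t : nuclear_norm (mx t) <= tuple_norm1 t.
Proof.
by rewrite (le_trans (nuclear_norm_le_sum svdP _))// (mx_of_tuple_sum Num.norm).
Qed.

Lemma norm1_le_nuclear_norm t : tuple_norm1 t <= N%:R * nuclear_norm (mx t).
Proof.
rewrite mulr_natl -[X in _ *+ X]card_ord -sumr_const ler_sum// => k _.
by case/mxvec_indexP: k => i j; rewrite -mx_of_tupleE; exact: entry_le_nuclear_norm.
Qed.

Lemma measurable_nuclear_norm : measurable_fun setT (fun t => nuclear_norm (mx t)).
Proof.
apply: measurable_tuple_lipschitz => t u; rewrite lerBlDr.
have -> : mx t = mx [tuple tnth t k - tnth u k | k < N] + mx u.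
  by apply/matrixP => i j; rewrite [RHS]mxE !mx_of_tupleE tnth_mktuple subrK.
rewrite (le_trans (ler_nuclear_normD svdP _ _))// lerD2r.
rewrite (le_trans (nuclear_norm_le_norm1 _))// ler_sum// => k _.
by rewrite tnth_mktuple.
Qed.

End tuple_matrix.

(** * Integrability and mass of the pseudo-posterior *)

Section pseudo_posterior.
Context {R : realType} (n m1 m2 : nat) (X : 'I_n -> 'M[R]_(m1, m2)).
Variables (y : 'I_n -> R) (lam tau : R).
Hypotheses (lam0 : 0 < lam) (tau0 : 0 < tau).
Hypothesis svdP : forall B : 'M[R]_(m1, m2),
  exists r (V1 : 'M[R]_(m1, r)) s (V2 : 'M[R]_(m2, r)), is_svd B V1 s V2.
Local Notation N := (m1 * m2)%N.
Local Notation mx := (@mx_of_tuple R m1 m2).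
Local Notation pm := (power_measure (@lebesgue_measure R) N).
Local Notation V := (potential X y lam).

Definition gibbs_weight (t : N.-tuple R) : R := expR (- V (mx t) / tau).
Local Notation w := gibbs_weight.

Lemma measurable_potential : measurable_fun setT (fun t => V (mx t)).
Proof.
apply: measurable_funD.
  apply: measurable_funM => //; apply: measurable_sum => i.
  by apply: measurable_funX; apply: measurable_funB => //; exact: measurable_mxdot.
by apply: measurable_funM => //; exact: measurable_nuclear_norm.
Qed.

Lemma measurable_gibbs_weight : measurable_fun setT w.
Proof.
apply: measurableT_comp => //; apply: measurable_funM => //.
by apply: measurableT_comp => //; exact: measurable_potential.
Qed.

(** The decay rate of the weight in [tuple_norm1]: the penalty alone gives it through
    [norm1_le_nuclear_norm]. [N.+1] avoids a division by zero when [N = 0]. *)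
Let a := lam / (N.+1%:R * tau).

Let a0 : 0 < a. Proof. by rewrite divr_gt0// mulr_gt0. Qed.

Let quad_ge0 B : 0 <= (2 * n%:R)^-1 * \sum_i (y i - mxdot (X i) B) ^+ 2.
Proof.
by rewrite mulr_ge0 ?invr_ge0// sumr_ge0// => i _; rewrite sqr_ge0.
Qed.

Lemma gibbs_weight_le t : w t <= expR (- (a * tuple_norm1 t)).
Proof.
rewrite ler_expR mulNr lerN2 ler_pdivlMr// /a.
have -> : lam / (N.+1%:R * tau) * tuple_norm1 t * tau = lam * (tuple_norm1 t / N.+1%:R).
  have : N.+1%:R != 0 :> R by rewrite pnatr_eq0.
  by move: (N.+1%:R : R) => M M0; field; rewrite M0 gt_eqF.
rewrite (le_trans _ (_ : lam * nuclear_norm (mx t) <= _))//; last first.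
  by rewrite /potential lerDr.
rewrite ler_pM2l// ler_pdivrMr// mulrC (le_trans (norm1_le_nuclear_norm svdP t))//.
by rewrite ler_wpM2r ?nuclear_norm_ge0// ler_nat.
Qed.

Lemma integrable_gibbs (g : N.-tuple R -> R) (C : R) : measurable_fun setT g ->
  (forall t, `|g t| <= C * (1 + tuple_norm1 t) ^+ 2) ->
  pm.-integrable setT (EFin \o (fun t => g t * w t)).
Proof.
(* Chosen so that [C2 * (1 + z ^+ 2 / 2)], at [z = a / 2 * S], contains [2 + 2 * S ^+ 2], which
   dominates [(1 + S) ^+ 2]. Half of the decay rate is spent on this growth. *)
move=> mg gC; pose C2 := 2 + 16 / a ^+ 2.
have C20 : 0 <= C2 by rewrite addr_ge0// divr_ge0// exprn_ge0// ltW.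
have a20 : 0 < a / 2 by rewrite divr_gt0.
have := integrableZl measurableT (`|C| * C2) (integrable_exp_sum_abs N a20).
apply: le_integrable => //.
  by apply/measurable_EFinP; apply: measurable_funM => //; exact: measurable_gibbs_weight.
move=> t _ /=; rewrite lee_fin !normrM (ger0_norm (expR_ge0 _)) normr_id.
rewrite (ger0_norm C20) (ger0_norm (expR_ge0 _)) -/(tuple_norm1 t).
set S := tuple_norm1 t; have S0 : 0 <= S := tuple_norm1_ge0 t.
have h1 : `|g t| <= `|C| * (C2 * expR (a / 2 * S)).
  rewrite (le_trans (gC t))// (le_trans (ler_wpM2r _ (ler_norm C)))// ?sqr_ge0//.
  rewrite ler_wpM2l//.
  have z0 : 0 <= a / 2 * S by rewrite mulr_ge0// ltW.
  have /(ler_wpM2l C20) := expR_ge1Dxn 1 z0; apply: le_trans.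
  have -> : C2 * (1 + (a / 2 * S) ^+ 2 / 2`!%:R) =
      2 + 2 * S ^+ 2 + 16 / a ^+ 2 + (a * S / 2) ^+ 2.
    by rewrite /C2 (_ : 2`!%:R = 2)//; field; rewrite gt_eqF.
  apply: (@le_trans _ _ (2 + 2 * S ^+ 2)).
    by rewrite -/S -subr_ge0 (_ : _ - _ = (S - 1) ^+ 2) ?sqr_ge0//; ring.
  by rewrite -(addrA (2 + 2 * S ^+ 2)) lerDl addr_ge0 ?sqr_ge0// divr_ge0// sqr_ge0.
have h2 := gibbs_weight_le t.
have w0 : 0 <= expR (- V (mx t) / tau) by exact: expR_ge0.
apply: le_trans (ler_pM (normr_ge0 _) w0 h1 h2) _.
rewrite (_ : - (a / 2 * S) = a / 2 * S + - (a * S)); last by field.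
by rewrite expRD !mulrA.
Qed.

Definition gibbs_mass : R := \int[pm]_t w t.
Local Notation Z := gibbs_mass.

Lemma integrable_gibbs_weight : pm.-integrable setT (EFin \o w).
Proof.
have := @integrable_gibbs (fun=> 1) 1 (measurable_cst _) _.
under eq_fun do rewrite mul1r.
apply=> t; rewrite normr1 mul1r -[leLHS](expr1n _ 2).
by rewrite lerXn2r ?nnegrE ?addr_ge0 ?tuple_norm1_ge0// lerDl tuple_norm1_ge0.
Qed.

(** On the unit cube, of volume one, the potential is at most [C], so the mass is at least
    [expR (- C / tau)]. *)
Lemma gibbs_mass_gt0 : 0 < Z.
Proof.
pose C := (2 * n%:R)^-1 * (\sum_i (`|y i| + (\sum_k \sum_l `|X i k l|) * N%:R) ^+ 2)
  + lam * N%:R.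
pose I1 (x : R) : R := \1_`[0, 1] x.
pose box (t : N.-tuple R) : R := \prod_k I1 (tnth t k).
have mI1 : measurable_fun setT I1 by exact: measurable_indic.
have mbox : measurable_fun setT box by apply: (measurable_fun_prod_tnth (f := fun=> I1)).
have intI1 : (\int[@lebesgue_measure R]_x (I1 x)%:E = 1%:E)%E.
  by rewrite integral_indic//= setIT lebesgue_measure_itv/= lte01 oppr0 adde0.
have intbox : (\int[pm]_t (box t)%:E = 1)%E.
  have I10 (_ : 'I_N) x : 0 <= I1 x by rewrite /I1 indicE ler0n.
  have := @ge0_integral_power_measure_prod _ _ R (@lebesgue_measure R) N
    (fun=> I1) (fun=> 1) (fun=> mI1) I10 (fun=> intI1).
  by rewrite big1_eq.
have box0 t : 0 <= box t by rewrite prodr_ge0.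
have le t : expR (- C / tau) * box t <= w t.
  have [tbox|/existsNP[k /negP kbox]] := pselect (forall k, 0 <= tnth t k <= 1); last first.
    rewrite /box (bigD1 k)//= /I1 indicE memNset ?mul0r ?mulr0 ?expR_ge0//=.
    by rewrite in_itv /= (negbTE kbox).
  rewrite /box big1 ?mulr1; last first.
    by move=> k _; rewrite /I1 indicE mem_set//= in_itv /=.
  rewrite ler_expR !mulNr lerN2 ler_pM2r ?invr_gt0//.
  have S : tuple_norm1 t <= N%:R.
    rewrite -[X in _ <= X%:R]card_ord -sumr_const ler_sum// => k _.
    by have /andP[? ?] := tbox k; rewrite ger0_norm.
  rewrite lerD//; last first.
    by rewrite ler_pM2l// (le_trans (nuclear_norm_le_norm1 svdP t)).
  rewrite ler_wpM2l ?invr_ge0// ler_sum// => i _.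
  rewrite -real_normK ?num_real// lerXn2r ?nnegrE//.
    by rewrite addr_ge0// mulr_ge0// sumr_ge0// => k _; apply: sumr_ge0.
  rewrite (le_trans (ler_normB _ _))// lerD2l (le_trans (normr_mxdot_le _ _))//.
  by rewrite ler_wpM2l// sumr_ge0// => k _; apply: sumr_ge0.
rewrite -lte_fin fineK; last exact: integrable_fin_num integrable_gibbs_weight.
apply: (@lt_le_trans _ _ (\int[pm]_t (expR (- C / tau) * box t)%:E)%E).
  under eq_integral do rewrite EFinM.
  rewrite ge0_integralZl//.
  - by rewrite intbox mule1 lte_fin expR_gt0.
  - exact/measurable_EFinP.
  - by move=> t _; rewrite lee_fin.
apply: ge0_le_integral => //.
- by move=> t _; rewrite lee_fin mulr_ge0// expR_ge0.
- by apply/measurable_EFinP; exact: measurable_funM.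
- by apply/measurable_EFinP; exact: measurable_gibbs_weight.
- by move=> t _; rewrite lee_fin.
Qed.

End pseudo_posterior.

(** * The inequality satisfied by the aggregate *)

Section aggregate_inequality.
Context {R : realType} (n m1 m2 : nat) (X : 'I_n -> 'M[R]_(m1, m2)).
Variables (y : 'I_n -> R) (lam tau : R).
Hypotheses (lam0 : 0 < lam) (tau0 : 0 < tau).
Hypothesis svdP : forall B : 'M[R]_(m1, m2),
  exists r (V1 : 'M[R]_(m1, r)) s (V2 : 'M[R]_(m2, r)), is_svd B V1 s V2.
Local Notation N := (m1 * m2)%N.
Local Notation mx := (@mx_of_tuple R m1 m2).
Local Notation pm := (power_measure (@lebesgue_measure R) N).
Local Notation V := (potential X y lam).
Local Notation w := (gibbs_weight X y lam tau).
Local Notation Z := (gibbs_mass X y lam tau).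
Local Notation Bh := (EWA X y lam tau).
Implicit Types (g : N.-tuple R -> R) (A B : 'M[R]_(m1, m2)).

Let Z0 : 0 < Z. Proof. exact: gibbs_mass_gt0. Qed.

(** A class on which [gibbs_mean] is linear and monotone, large enough to contain the potential and
    squared linear forms. *)
Definition quadratic_growth g := measurable_fun setT g /\
  exists C, forall t, `|g t| <= C * (1 + tuple_norm1 t) ^+ 2.

Let growth_ge1 (t : N.-tuple R) : 1 <= (1 + tuple_norm1 t) ^+ 2.
Proof. by rewrite exprn_ege1// lerDl tuple_norm1_ge0. Qed.

Let growth_geN (t : N.-tuple R) : tuple_norm1 t <= (1 + tuple_norm1 t) ^+ 2.
Proof. by have := tuple_norm1_ge0 t; nra. Qed.

Lemma quadratic_growth_cst c : quadratic_growth (fun=> c).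
Proof. by split=> //; exists `|c| => t; rewrite ler_peMr. Qed.

Lemma quadratic_growthD g1 g2 : quadratic_growth g1 -> quadratic_growth g2 ->
  quadratic_growth (fun t => g1 t + g2 t).
Proof.
move=> [mg1 [C1 h1]] [mg2 [C2 h2]]; split; first exact: measurable_funD.
by exists (C1 + C2) => t; rewrite mulrDl (le_trans (ler_normD _ _))// lerD.
Qed.

Lemma quadratic_growthZ c g : quadratic_growth g -> quadratic_growth (fun t => c * g t).
Proof.
move=> [mg [C h]]; split; first exact: measurable_funM.
by exists (`|c| * C) => t; rewrite normrM -mulrA ler_wpM2l.
Qed.

Lemma quadratic_growth_sum (I : Type) (r : seq I) (G : I -> N.-tuple R -> R) :
  (forall i, quadratic_growth (G i)) ->
  quadratic_growth (fun t => \sum_(i <- r) G i t).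
Proof.
move=> h; elim: r => [|i r IH].
  under eq_fun do rewrite big_nil.
  exact: quadratic_growth_cst.
under eq_fun do rewrite big_cons.
exact: quadratic_growthD.
Qed.

Lemma quadratic_growth_mxdot A : quadratic_growth (fun t => mxdot A (mx t)).
Proof.
split; first exact: measurable_mxdot.
exists (\sum_i \sum_j `|A i j|) => t; rewrite (le_trans (normr_mxdot_le _ _))//.
by rewrite ler_wpM2l// sumr_ge0// => i _; apply: sumr_ge0.
Qed.

Lemma quadratic_growth_sqr c A : quadratic_growth (fun t => (c - mxdot A (mx t)) ^+ 2).
Proof.
split.
  by apply: measurable_funX; apply: measurable_funB => //; exact: measurable_mxdot.
pose D := \sum_i \sum_j `|A i j|.
have D0 : 0 <= D by apply: sumr_ge0 => i _; apply: sumr_ge0.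
exists ((`|c| + D) ^+ 2) => t; rewrite normrX -exprMn.
have t0 := tuple_norm1_ge0 t; have c0 := normr_ge0 c.
rewrite lerXn2r ?nnegrE ?mulr_ge0 ?addr_ge0// (le_trans (ler_normB _ _))//.
have := normr_mxdot_le A t; rewrite -/D; nra.
Qed.

Lemma quadratic_growth_nuclear : quadratic_growth (fun t => nuclear_norm (mx t)).
Proof.
split; first exact: measurable_nuclear_norm.
exists 1 => t; rewrite mul1r ger0_norm ?nuclear_norm_ge0//.
by rewrite (le_trans (nuclear_norm_le_norm1 svdP t)).
Qed.

Lemma quadratic_growth_potential : quadratic_growth (fun t => V (mx t)).
Proof.
apply: quadratic_growthD.
  apply: quadratic_growthZ; apply: quadratic_growth_sum => i.
  exact: quadratic_growth_sqr.
by apply: quadratic_growthZ; exact: quadratic_growth_nuclear.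
Qed.

Lemma quadratic_growth_sqrB A B : quadratic_growth (fun t => mxdot A (mx t - B) ^+ 2).
Proof.
rewrite (_ : (fun t => _) = fun t => (mxdot A B - mxdot A (mx t)) ^+ 2).
  exact: quadratic_growth_sqr.
by apply/funext => t; rewrite mxdotBr -[LHS]sqrrN opprB.
Qed.

Lemma quadratic_growth_sqnorm B : quadratic_growth (fun t => sqnormL2 X (mx t - B)).
Proof.
apply: quadratic_growthZ; apply: quadratic_growth_sum => i.
exact: quadratic_growth_sqrB.
Qed.

Definition gibbs_mean g : R := \int[pm]_t (g t * w t) / Z.
Local Notation mean := gibbs_mean.

Let integrable_growth g : quadratic_growth g ->
  pm.-integrable setT (EFin \o (fun t => g t * w t)).
Proof. by move=> [mg [C gC]]; exact: integrable_gibbs gC. Qed.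

Lemma gibbs_meanD g1 g2 : quadratic_growth g1 -> quadratic_growth g2 ->
  mean (fun t => g1 t + g2 t) = mean g1 + mean g2.
Proof.
move=> h1 h2; rewrite /mean -mulrDl -RintegralD//; try exact: integrable_growth.
by congr (_ / _); apply: eq_Rintegral => t _; rewrite mulrDl.
Qed.

Lemma gibbs_meanZ c g : quadratic_growth g ->
  mean (fun t => c * g t) = c * mean g.
Proof.
move=> h; rewrite /mean mulrA -RintegralZl//; last exact: integrable_growth.
by congr (_ / _); apply: eq_Rintegral => t _; rewrite mulrA.
Qed.

Lemma gibbs_mean_cst c : mean (fun=> c) = c.
Proof.
rewrite /mean RintegralZl//; last exact: integrable_gibbs_weight.
by rewrite mulfK// gt_eqF.
Qed.

Lemma gibbs_mean_sum (I : Type) (r : seq I) (G : I -> N.-tuple R -> R) :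
  (forall i, quadratic_growth (G i)) ->
  mean (fun t => \sum_(i <- r) G i t) = \sum_(i <- r) mean (G i).
Proof.
move=> h; elim: r => [|i r IH].
  rewrite big_nil; under eq_fun do rewrite big_nil.
  exact: gibbs_mean_cst.
rewrite big_cons -IH -gibbs_meanD//; last exact: quadratic_growth_sum.
by congr mean; apply/funext => t; rewrite big_cons.
Qed.

Lemma le_gibbs_mean g1 g2 : quadratic_growth g1 -> quadratic_growth g2 ->
  (forall t, g1 t <= g2 t) -> mean g1 <= mean g2.
Proof.
move=> h1 h2 le; rewrite /mean ler_pM2r ?invr_gt0//.
apply: le_Rintegral => //; try exact: integrable_growth.
by move=> t _; rewrite ler_wpM2r// expR_ge0.
Qed.

Lemma gibbs_mean_mxdot A : mean (fun t => mxdot A (mx t)) = mxdot A Bh.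
Proof.
rewrite mxdotE; under eq_fun do rewrite mxdotE.
have entry i j : quadratic_growth (fun t => mx t i j).
  have := quadratic_growth_mxdot (delta_mx i j).
  by under eq_fun do rewrite mxdot_delta.
rewrite gibbs_mean_sum => [|i]; last first.
  by apply: quadratic_growth_sum => j; exact: quadratic_growthZ.
apply: eq_bigr => i _; rewrite gibbs_mean_sum => [|j]; last exact: quadratic_growthZ.
apply: eq_bigr => j _; rewrite gibbs_meanZ//; congr (_ * _).
rewrite mxE /mx_Rintegral /mean -RintegralZr//; last exact: integrable_growth.
by apply: eq_Rintegral => t _; rewrite /pseudo_posterior mulrA.
Qed.

(* Jensen's inequality at the mean [Bh], from an affine minorant. *)
Lemma le_gibbs_mean_affine c A g : quadratic_growth g ->
  (forall t, c + mxdot A (mx t - Bh) <= g t) -> c <= mean g.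
Proof.
move=> hg le; have hA := quadratic_growth_mxdot A.
have -> : c = mean (fun t => (c - mxdot A Bh) + mxdot A (mx t)).
  rewrite gibbs_meanD//; last exact: quadratic_growth_cst.
  by rewrite gibbs_mean_cst gibbs_mean_mxdot subrK.
apply: le_gibbs_mean => //.
  by apply: quadratic_growthD => //; exact: quadratic_growth_cst.
by move=> t; rewrite -addrA [- _ + _]addrC -mxdotBr.
Qed.

Let sqr_tangent (c u v : R) : (c - u) ^+ 2 + - (2 * (c - u)) * (v - u) <= (c - v) ^+ 2.
Proof. by have := sqr_ge0 (v - u); nra. Qed.

(** The affine minorants at [Bh] are the tangent line for each square and, for the nuclear norm, the
    form [mxdot W] with [W] dual optimal at [Bh]. *)
Lemma potential_le_mean : V Bh <= mean (fun t => V (mx t)).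
Proof.
rewrite /potential gibbs_meanD; last 2 first.
- apply: quadratic_growthZ; apply: quadratic_growth_sum => i.
  exact: quadratic_growth_sqr.
- by apply: quadratic_growthZ; exact: quadratic_growth_nuclear.
rewrite gibbs_meanZ; last exact: quadratic_growth_nuclear.
rewrite gibbs_meanZ; last first.
  by apply: quadratic_growth_sum => i; exact: quadratic_growth_sqr.
rewrite gibbs_mean_sum => [|i]; last exact: quadratic_growth_sqr.
rewrite lerD//.
  rewrite ler_wpM2l ?invr_ge0// ler_sum// => i _.
  apply: (@le_gibbs_mean_affine _ (- (2 * (y i - mxdot (X i) Bh)) *: X i)).
    exact: quadratic_growth_sqr.
  by move=> t; rewrite mxdotZl mxdotBr; exact: sqr_tangent.
rewrite ler_pM2l//.
have [W W1 <-] := nuclear_duality_attained svdP Bh.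
apply: (@le_gibbs_mean_affine _ W); first exact: quadratic_growth_nuclear.
move=> t; rewrite -mxdotDr addrC subrK -[leRHS]mul1r.
exact: (nuclear_duality svdP).
Qed.

Lemma sqnorm_le_mean B : sqnormL2 X (Bh - B) <= mean (fun t => sqnormL2 X (mx t - B)).
Proof.
rewrite /sqnormL2.
have h i := quadratic_growth_sqrB (X i) B.
rewrite gibbs_meanZ; last by apply: quadratic_growth_sum => i; exact: h.
rewrite gibbs_mean_sum// ler_wpM2l ?invr_ge0// ler_sum// => i _.
apply: (@le_gibbs_mean_affine _ (2 * mxdot (X i) (Bh - B) *: X i)) => // t.
rewrite mxdotZl !mxdotBr.
have := sqr_ge0 (mxdot (X i) (mx t) - mxdot (X i) Bh); nra.
Qed.

(** The quadratic part satisfies this with equality; the nuclear norm contributes plain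
    convexity. *)
Lemma potential_convex s A B : 0 <= s <= 1 ->
  V ((1 - s) *: B + s *: A) + 2^-1 * (s * (1 - s) * sqnormL2 X (A - B)) <=
  (1 - s) * V B + s * V A.
Proof.
move=> /andP[s0 s1]; have s10 : 0 <= 1 - s by rewrite subr_ge0.
have hn := nuclear_norm_comb svdP B A s10 s0.
rewrite /potential.
have -> : (2 * n%:R)^-1 * \sum_i (y i - mxdot (X i) ((1 - s) *: B + s *: A)) ^+ 2 =
    (1 - s) * ((2 * n%:R)^-1 * \sum_i (y i - mxdot (X i) B) ^+ 2)
    + s * ((2 * n%:R)^-1 * \sum_i (y i - mxdot (X i) A) ^+ 2)
    - 2^-1 * (s * (1 - s) * sqnormL2 X (A - B)).
  rewrite /sqnormL2 invfM !mulr_sumr -big_split /= -sumrB.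
  apply: eq_bigr => i _; rewrite !mxdotDr !mxdotZr mxdotNr.
  by move: n%:R^-1 => k; field.
have := ler_wpM2l (ltW lam0) hn.
move: (nuclear_norm _) (nuclear_norm A) (nuclear_norm B) (sqnormL2 _ _) => u a b q.
move: ((2 * n%:R)^-1 * _) ((2 * n%:R)^-1 * _) => fB fA.
by lra.
Qed.

(** Integrate [g t * w t <= w (aff t)] and evaluate the right side by the change of variables.
    Negative powers of [s] are cleared so that the limit at [s = 1] concerns polynomials in [s]. *)
Lemma gibbs_mean_dilation s B : 0 < s < 1 ->
  (1 - s) * (mean (fun t => V (mx t)) - V B
    + 2^-1 * (s * mean (fun t => sqnormL2 X (mx t - B)))) * s ^+ N
  <= tau * (1 - s ^+ N).
Proof.
move=> /andP[s0 s1].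
pose aff := affine_tuple (fun k => (1 - s) * mxvec B 0 k) s : N.-tuple R -> N.-tuple R.
have mw : measurable_fun setT w by exact: measurable_gibbs_weight.
have maff : measurable_fun setT (w \o aff).
  exact: measurableT_comp mw (measurable_affine_tuple _ _).
have Eaff : (\int[pm]_t (w (aff t))%:E = (s ^- N * Z)%:E)%E.
  have EZ : (\int[pm]_t (w t)%:E = Z%:E)%E.
    rewrite fineK//; apply: integrable_fin_num => //.
    exact: integrable_gibbs_weight.
  rewrite EFinM -EZ; apply: (@ge0_integral_affine_tuple R N _ s (EFin \o w) s0).
    by have /measurable_EFinP := mw.
  by move=> t; rewrite lee_fin expR_ge0.
have iaff : pm.-integrable setT (EFin \o (w \o aff)).
  apply/integrableP; split; first exact/measurable_EFinP.
  under eq_integral do rewrite /= ger0_norm ?expR_ge0//.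
  by rewrite Eaff ltry.
have key (a b c q : R) : c + 2^-1 * (s * (1 - s) * q) <= (1 - s) * b + s * a ->
    - a / tau + (1 - s) / tau * (a - b + 2^-1 * (s * q)) <= - c / tau.
  move=> h; rewrite mulrAC -mulrDl ler_pM2r ?invr_gt0//.
  by lra.
pose g t := 1 + (1 - s) / tau * (V (mx t) - V B + 2^-1 * (s * sqnormL2 X (mx t - B))).
have hV : quadratic_growth (fun t => V (mx t) - V B).
  by apply: quadratic_growthD; [exact: quadratic_growth_potential|exact: quadratic_growth_cst].
have hq : quadratic_growth (fun t => 2^-1 * (s * sqnormL2 X (mx t - B))).
  by do 2 apply: quadratic_growthZ; exact: quadratic_growth_sqnorm.
have hg : quadratic_growth g.
  apply: quadratic_growthD; first exact: quadratic_growth_cst.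
  by apply: quadratic_growthZ; exact: quadratic_growthD.
have mg : mean g = 1 + (1 - s) / tau * (mean (fun t => V (mx t)) - V B
    + 2^-1 * (s * mean (fun t => sqnormL2 X (mx t - B)))).
  rewrite /g gibbs_meanD; [|exact: quadratic_growth_cst|]; last first.
    by apply: quadratic_growthZ; exact: quadratic_growthD.
  rewrite gibbs_mean_cst gibbs_meanZ; last exact: quadratic_growthD.
  rewrite gibbs_meanD//; congr (_ + _ * (_ + _)).
    rewrite gibbs_meanD ?gibbs_mean_cst//; first exact: quadratic_growth_potential.
    exact: quadratic_growth_cst.
  rewrite gibbs_meanZ; last by apply: quadratic_growthZ; exact: quadratic_growth_sqnorm.
  by rewrite gibbs_meanZ//; exact: quadratic_growth_sqnorm.
have le : \int[pm]_t (g t * w t) <= \int[pm]_t (w (aff t)).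
  apply: le_Rintegral => //; first exact: integrable_growth.
  move=> t _; rewrite /gibbs_weight mx_of_tuple_affine.
  have s01 : 0 <= s <= 1 by rewrite !ltW.
  have cv := potential_convex (mx t) B s01.
  rewrite mulrC /g; set h := (1 - s) / tau * _.
  apply: (@le_trans _ _ (expR (- V (mx t) / tau) * expR h)).
    by rewrite ler_wpM2l ?expR_ge0// expR_ge1Dx.
  by rewrite -expRD ler_expR; exact: key.
have ER : \int[pm]_t (w (aff t)) = s ^- N * Z by exact: (congr1 fine Eaff).
rewrite ER -ler_pdivrMr// -/(mean g) mg in le.
have sN : 0 < s ^+ N by rewrite exprn_gt0.
move: le; rewrite -(ler_pM2r sN) mulVf ?gt_eqF// mulrDl mul1r.
rewrite -lerBrDl -(ler_pM2l tau0); congr (_ <= _).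
by field; rewrite gt_eqF.
Qed.

Lemma aggregate_inequality B :
  V Bh + 2^-1 * sqnormL2 X (Bh - B) <= V B + N%:R * tau.
Proof.
set M := mean (fun t => V (mx t)); set Q := mean (fun t => sqnormL2 X (mx t - B)).
have main e : 0 < e < 1 ->
    0 <= N%:R * tau - (M - V B + 2^-1 * ((1 - e) * Q)) * (1 - e) ^+ N.
  move=> /andP[e0 e1]; have := @gibbs_mean_dilation (1 - e) B.
  rewrite subKr -/M -/Q => /(_ _)/wrap[]; first by apply/andP; split; lra.
  (* Bernoulli's inequality makes the right side of [gibbs_mean_dilation] proportional to [e], which
     cancels the factor [1 - s = e] on the left before the limit. *)
  have bern : 1 - (1 - e) ^+ N <= N%:R * e.
    elim: N => [|k IH]; first by rewrite expr0 mul0r subrr.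
    have ke : 0 <= k%:R * e * e by rewrite !mulr_ge0// ltW.
    have e10 : 0 <= 1 - e by lra.
    have := ler_wpM2l e10 IH; rewrite exprS -natr1.
    by move: ((1 - e) ^+ k) (k%:R : R) ke => z q ke; lra.
  move=> h; rewrite subr_ge0 -(ler_pM2l e0) mulrA (le_trans h)//.
  by rewrite mulrCA mulrC mulrA ler_pM2r.
suff : 0 <= N%:R * tau - (M - V B + 2^-1 * ((1 - 0) * Q)) * (1 - 0) ^+ N.
  rewrite subr0 expr1n mulr1 mul1r.
  have := potential_le_mean; have := sqnorm_le_mean B; rewrite -/M -/Q.
  by clear main; move: M Q (V Bh) (V B) (sqnormL2 _ _) => M Q vh vb q; lra.
apply: (@continuous_ge0_right R (fun e => N%:R * tau -
  (M - V B + 2^-1 * ((1 - e) * Q)) * (1 - e) ^+ N)) => //.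
have c1 : continuous (fun e : R => 1 - e).
  by move=> x; apply: cvgB; [exact: cvg_cst|exact: cvg_id].
move=> x; apply: cvgB; first exact: cvg_cst.
apply: cvgM.
  apply: cvgD; first exact: cvg_cst.
  apply: cvgM; first exact: cvg_cst.
  by apply: cvgM; [exact: c1|exact: cvg_cst].
apply: (@continuous_comp _ _ _ (fun e : R => 1 - e) (fun z : R => z ^+ N)).
  exact: c1.
exact: exprn_continuous.
Qed.

End aggregate_inequality.

(** * The oracle inequality on the noise event *)

Section oracle_inequality.
Context {R : realType} (n m1 m2 : nat) (X : 'I_n -> 'M[R]_(m1, m2)).
Variables (Bstar : 'M[R]_(m1, m2)) (y xi : 'I_n -> R) (lam tau : R).
Hypotheses (n0 : (0 < n)%N) (lam0 : 0 < lam) (tau0 : 0 < tau).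
Hypothesis svdP : forall B : 'M[R]_(m1, m2),
  exists r (V1 : 'M[R]_(m1, r)) s (V2 : 'M[R]_(m2, r)), is_svd B V1 s V2.
Hypothesis yE : forall i, y i = mxdot (X i) Bstar + xi i.
Hypothesis noise : bilinear_le (n%:R * lam / 2) (\sum_i xi i *: X i).
Local Notation Bh := (EWA X y lam tau).
Local Notation V := (potential X y lam).
Implicit Types B : 'M[R]_(m1, m2).

Lemma sqnormL2_ge0 B : 0 <= sqnormL2 X B.
Proof. by rewrite mulr_ge0 ?invr_ge0// sumr_ge0// => i _; rewrite sqr_ge0. Qed.

(** Isolates the noise as a linear term; the sum of the [xi i ^+ 2] does not depend on [B] and
    cancels between [Bh] and [B]. *)
Let potentialE B : V B = 2^-1 * pred_loss X B Bstar
  - n%:R^-1 * mxdot (\sum_i xi i *: X i) (B - Bstar)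
  + n%:R^-1 * (\sum_i 2^-1 * xi i ^+ 2) + lam * nuclear_norm B.
Proof.
rewrite /potential /pred_loss /sqnormL2; congr (_ + _).
rewrite mxdot_suml invfM !mulr_sumr -sumrB -big_split /=; apply: eq_bigr => i _.
by rewrite yE mxdotZl !mxdotBr; move: n%:R^-1 => k; field.
Qed.

(** Twice [aggregate_inequality]. The noise costs [lam] times the norms of both parts of [U]; the
    penalty gives [2 * lam] times the bound of [nuclear_norm_projection]. Adding, the perpendicular
    part gets [1 + 2 = 3], the projected part [1 - 2 = -1], and the projection of [B] gets 4. *)
Lemma basic_oracle_inequality r B (V1 : 'M[R]_(m1, r)) s (V2 : 'M[R]_(m2, r)) J :
  is_svd B V1 s V2 ->
  pred_loss X Bh Bstar + sqnormL2 X (Bh - B) <=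
  pred_loss X B Bstar + 4 * lam * nuclear_norm (projc V1 V2 J B)
  + lam * (3 * nuclear_norm (projc_perp V1 V2 J (Bh - B))
           - nuclear_norm (projc V1 V2 J (Bh - B)))
  + 2 * (m1 * m2)%:R * tau.
Proof.
move=> svdB; have := aggregate_inequality X y lam0 tau0 svdP B.
rewrite !potentialE.
have -> : Bh - Bstar = (Bh - B) + (B - Bstar) by rewrite addrA subrK.
rewrite mxdotDr mulrDr; set U := Bh - B.
have Ule : nuclear_norm U <= nuclear_norm (projc V1 V2 J U)
    + nuclear_norm (projc_perp V1 V2 J U).
  by rewrite -[in leLHS](subrKC (projc V1 V2 J U) U); exact: ler_nuclear_normD.
have noiseU : n%:R^-1 * mxdot (\sum_i xi i *: X i) U <= lam / 2 * nuclear_norm U.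
  rewrite mulrC ler_pdivrMr ?ltr0n//; have := nuclear_duality svdP U noise.
  by congr (_ <= _); ring.
have := nuclear_norm_projection svdP J svdB Bh; rewrite -/U.
move: (ler_wpM2l (ltW lam0) Ule) noiseU.
move=> h1 h2 /(ler_wpM2l (ltW lam0)).
move: h1 h2; move: (nuclear_norm U) (nuclear_norm Bh) (nuclear_norm B).
move: (nuclear_norm _) (nuclear_norm _) (nuclear_norm _) (pred_loss _ _ _) (pred_loss _ _ _).
move: (n%:R^-1 * _) (n%:R^-1 * _) (n%:R^-1 * _) (sqnormL2 _ _) ((m1 * m2)%:R : R) => *; lra.
Qed.

Lemma oracle_inequality r B (V1 : 'M[R]_(m1, r)) s (V2 : 'M[R]_(m2, r)) J :
  is_svd B V1 s V2 ->
  ((pred_loss X Bh Bstar)%:E <= (pred_loss X B Bstar)%:E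
     + (4 * lam * nuclear_norm (projc V1 V2 J B))%:E
     + (9 * lam ^+ 2 * #|J|%:R)%:E / (4%:E * compat X V1 V2 J 3)
     + (2 * (m1 * m2)%:R * tau)%:E)%E.
Proof.
move=> svdB; have := basic_oracle_inequality J svdB.
set U := Bh - B; set S := sqnormL2 X U; set K := compat _ _ _ _ _.
set a := nuclear_norm (projc V1 V2 J U); set b := nuclear_norm (projc_perp V1 V2 J U).
have S0 : 0 <= S by exact: sqnormL2_ge0.
have K0 : (0 <= K)%E.
  apply: le_ereal_inf_tmp => _ [W _ <-]; rewrite lee_fin divr_ge0 ?sqr_ge0//.
  by rewrite mulr_ge0 ?sqnormL2_ge0// mulr_ge0.
set p := pred_loss X Bh Bstar; set q := pred_loss X B Bstar + _ * _.
set e := 2 * _ * tau; move=> main.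
(* The compatibility term may be [+oo]; a real number [c] below it brings the argument back to
   [R]. *)
suff [c cK hc] : exists2 c : R, (c%:E <= (9 * lam ^+ 2 * #|J|%:R)%:E / (4%:E * K))%E &
    p <= q + c + e.
  apply: le_trans (_ : (q + c + e)%:E <= _)%E; first by rewrite lee_fin.
  by rewrite !EFinD leeD// leeD.
have J9 : 0 <= 9 * lam ^+ 2 * #|J|%:R.
  by rewrite mulr_ge0// mulr_ge0// sqr_ge0.
have [z0|z0] := leP (3 * b - a) 0.
  exists 0; last by have := mulr_ge0_le0 (ltW lam0) z0; lra.
  by rewrite mule_ge0 ?lee_fin// inve_ge0 mule_ge0.
have KS : (K <= (3 ^+ 2 * #|J|%:R * S / (3 * b - a) ^+ 2)%:E)%E.
  by apply: ereal_inf_lbound; exists U => //=; rewrite -subr_gt0.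
(* For empty [J] the projection is the identity, so [b = 0], contradicting [0 < 3 * b - a]. *)
have cJ : 0 < #|J|%:R :> R.
  rewrite ltr0n lt0n; apply/negP => /eqP/cards0_eq J0; move: z0.
  rewrite ltNge => /negP; apply.
  rewrite subr_le0 (_ : b = 0) ?mulr0 ?nuclear_norm_ge0//.
  have noJ m (W : 'M[R]_(m, r)) : cols W J *m (cols W J)^T = 0.
    rewrite cols_mulmx_tr (_ : diag_mx _ = 0) ?mulmx0 ?mul0mx//.
    by apply/matrixP => i j; rewrite J0 !mxE inE mul0rn.
  rewrite /b /projc_perp /projc !noJ !subr0 mul1mx mulmx1 subrr.
  apply/eqP; rewrite eq_le nuclear_norm_ge0// andbT.
  rewrite (le_trans (nuclear_norm_le_sum svdP _))// big1// => i _.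
  by rewrite big1// => j _; rewrite mxE normr0.
have {}J9 : 0 < 9 * lam ^+ 2 * #|J|%:R by rewrite !mulr_gt0// exprn_gt0.
have : K \is a fin_num by rewrite ge0_fin_numE// (le_lt_trans KS)// ltry.
move: K K0 KS => [k| |]//; rewrite !lee_fin => k0 + _.
rewrite ler_pdivlMr ?exprn_gt0// => kS.
move: k0; rewrite le_eqVlt => /predU1P[<-|k0].
  (* Here [K = 0] with a positive numerator: the term is [+oo] and any real number lies below it. *)
  exists (p - q - e); last lra.
  by rewrite mule0 inve0 gt0_muley ?leey// lte_fin.
exists (9 * lam ^+ 2 * #|J|%:R / (4 * k)).
  by rewrite -EFinM inver ?gt_eqF ?mulr_gt0.
(* Complete the square in [z]; the quadratic term is at most [S] because [U] competes in the
   infimum, and [S] is on the left of [main]. The 9 is the square of the constant 3. *)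
have : lam * (3 * b - a) <= S + 9 * lam ^+ 2 * #|J|%:R / (4 * k).
  set z := 3 * b - a in kS z0 *.
  have h1 : k * z ^+ 2 / (9 * #|J|%:R) <= S.
    by rewrite ler_pdivrMr ?mulr_gt0//; lra.
  apply: le_trans (lerD h1 (lexx _)); rewrite -subr_ge0.
  have -> : k * z ^+ 2 / (9 * #|J|%:R) + 9 * lam ^+ 2 * #|J|%:R / (4 * k) - lam * z
      = (2 * k * z - 9 * #|J|%:R * lam) ^+ 2 / (36 * #|J|%:R * k).
    by field; rewrite !gt_eqF.
  by rewrite divr_ge0 ?sqr_ge0// !mulr_ge0// ltW.
by lra.
Qed.

End oracle_inequality.

(** Tonelli on the positive and negative parts separately, followed by measurability of [fine]. *)
Lemma measurable_Rintegral_param d1 d2 (T1 : measurableType d1) (T2 : measurableType d2)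
    (R : realType) (mu : {sigma_finite_measure set T2 -> \bar R}) (f : T1 * T2 -> R) :
  measurable_fun setT f -> measurable_fun setT (fun x => \int[mu]_t f (x, t)).
Proof.
move=> /measurable_EFinP mf; apply: measurableT_comp; first exact: fine_measurable.
under eq_fun do rewrite integralE.
apply: emeasurable_funB.
- have := @measurable_fun_fubini_tonelli_F _ _ T1 T2 R mu _
    (measurable_funepos mf) (funepos_ge0 _).
  congr (measurable_fun _ _); apply/funext => x; apply: eq_integral => t _.
  by rewrite !funeposE.
- have := @measurable_fun_fubini_tonelli_F _ _ T1 T2 R mu _
    (measurable_funeneg mf) (funeneg_ge0 _).
  congr (measurable_fun _ _); apply/funext => x; apply: eq_integral => t _.
  by rewrite !funenegE.
Qed.

(** * Measurability of the aggregate in the data *)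

Section measurable_EWA.
Context {R : realType} (n m1 m2 : nat) (X : 'I_n -> 'M[R]_(m1, m2)).
Context d (Omega : measurableType d) (y : Omega -> 'I_n -> R) (lam tau : R).
Hypotheses (lam0 : 0 < lam) (tau0 : 0 < tau).
Hypothesis svdP : forall B : 'M[R]_(m1, m2),
  exists r (V1 : 'M[R]_(m1, r)) s (V2 : 'M[R]_(m2, r)), is_svd B V1 s V2.
Hypothesis my : forall i, measurable_fun setT (fun w => y w i).
Local Notation N := (m1 * m2)%N.
Local Notation mx := (@mx_of_tuple R m1 m2).
Local Notation pm := (power_measure (@lebesgue_measure R) N).

Let measurable_joint_weight : measurable_fun setT
  (fun z : Omega * N.-tuple R => gibbs_weight X (y z.1) lam tau z.2).
Proof.
apply: measurableT_comp => //; apply: measurable_funM => //.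
apply: measurableT_comp => //; apply: measurable_funD.
  apply: measurable_funM => //; apply: measurable_sum => i.
  apply: measurable_funX; apply: measurable_funB.
    exact: measurableT_comp (my i) measurable_fst.
  exact: measurableT_comp (measurable_mxdot (X i)) measurable_snd.
apply: measurable_funM => //.
exact: measurableT_comp (measurable_nuclear_norm svdP) measurable_snd.
Qed.

Let measurable_mass : measurable_fun setT (fun w => gibbs_mass X (y w) lam tau).
Proof.
exact: (@measurable_Rintegral_param _ _ Omega _ R pm (fun z : Omega * N.-tuple R =>
  gibbs_weight X (y z.1) lam tau z.2)).
Qed.

Lemma measurable_EWA i j : measurable_fun setT (fun w => EWA X (y w) lam tau i j).
Proof.
under eq_fun do rewrite mxE.
apply: (@measurable_Rintegral_param _ _ Omega _ R pm (fun z : Omega * N.-tuple R =>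
  mx z.2 i j * pseudo_posterior X (y z.1) lam tau (mx z.2))).
apply: measurable_funM.
  under eq_fun do rewrite mx_of_tupleE.
  exact: measurableT_comp (measurable_tnth _) measurable_snd.
apply: measurable_funM; first exact: measurable_joint_weight.
(* The mass is positive, so its inverse is a composition of measurable functions, [expR] and
   [ln]. *)
have -> : (fun z : Omega * N.-tuple R => (mx_Rintegral (fun B : 'M[R]_(m1, m2) =>
    expR (- potential X (y z.1) lam B / tau)))^-1) =
    fun z => expR (- ln (gibbs_mass X (y z.1) lam tau)).
  by apply/funext => z; rewrite expRN lnK ?posrE//; exact: gibbs_mass_gt0.
apply: measurableT_comp => //; apply: measurableT_comp => //.
apply: measurableT_comp; first exact: measurable_ln.
exact: measurableT_comp measurable_mass measurable_fst.
Qed.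

Lemma measurable_pred_loss_EWA B :
  measurable_fun setT (fun w => pred_loss X (EWA X (y w) lam tau) B).
Proof.
apply: measurable_funM => //; apply: measurable_sum => i; apply: measurable_funX.
under eq_fun do rewrite mxdotBr.
apply: measurable_funB => //; under eq_fun do rewrite mxdotE.
apply: measurable_sum => k; apply: measurable_sum => l; apply: measurable_funM => //.
exact: measurable_EWA.
Qed.

End measurable_EWA.

Lemma noise_event (R : realType) (n m1 m2 : nat) (X : 'I_n -> 'M[R]_(m1, m2))
    (sigma lam delta : R) : (0 < n)%N -> (0 < m1)%N -> 0 < sigma -> 0 < lam ->
  0 < delta -> delta < 1 ->
  2 * sigma * design_const X *
    Num.sqrt (2 / n%:R * ln ((m1 + m2)%:R / delta)) <= lam ->
  exists2 E : set (n.-tuple R), measurable E &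
    ((1 - delta)%:E <= iid_normal sigma E)%E /\
    forall x, E x -> bilinear_le (n%:R * lam / 2) (\sum_i tnth x i *: X i).
Proof.
move=> n0 m10 sigma0 lam0 delta0 delta1.
set L := ln _; set q := Num.sqrt _ => hlam.
have m0 : 1 <= (m1 + m2)%:R :> R by rewrite ler1n addn_gt0 m10.
have md0 : 1 < (m1 + m2)%:R / delta by rewrite ltr_pdivlMr// mul1r (lt_le_trans delta1).
have L0 : 0 < L by rewrite ln_gt0.
have nR0 : 0 < n%:R :> R by rewrite ltr0n.
have q2 : q ^+ 2 = 2 / n%:R * L by rewrite sqr_sqrtr// mulr_ge0 ?divr_ge0// ltW.
have q0 : 0 < q by rewrite sqrtr_gt0 mulr_gt0// divr_gt0.
(* [design_const X] may vanish, while the tail bound asks for a positive scale; [w] is the largest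
   scale compatible with the condition on [lam]. *)
pose w := lam / (2 * sigma * q).
have w0 : 0 < w by rewrite divr_gt0// !mulr_gt0.
have vw : design_const X <= w.
  rewrite ler_pdivlMr ?mulr_gt0//; apply: le_trans hlam.
  by rewrite mulrC -mulrAC.
have opw k (M : 'M[R]_k) : Num.sqrt (opnorm M) <= design_const X -> opnorm M <= w ^+ 2.
  move=> /le_trans/(_ vw) h; rewrite -(sqr_sqrtr (opnorm_ge0 M)).
  by rewrite lerXn2r ?nnegrE ?sqrtr_ge0// ltW.
have Xw1 : opnorm (n%:R^-1 *: \sum_i X i *m (X i)^T) <= w ^+ 2.
  by apply: opw; rewrite le_max lexx.
have Xw2 : opnorm (n%:R^-1 *: \sum_i (X i)^T *m X i) <= w ^+ 2.
  by apply: opw; rewrite le_max lexx orbT.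
have t0 : 0 < n%:R * lam / 2 by rewrite divr_gt0// mulr_gt0.
have [E mE [PE hE]] := gaussian_series_tail n0 sigma0 w0 Xw1 Xw2 t0.
exists E => //; split => //; apply: le_trans PE.
rewrite lee_fin lerD2l lerN2.
(* For this [w] the tail exponent is exactly [L], so the failure probability is exactly [delta]. *)
have -> : (n%:R * lam / 2) ^+ 2 / (2 * sigma ^+ 2 * (n%:R * w ^+ 2)) = L.
  have -> : w ^+ 2 = lam ^+ 2 / (4 * sigma ^+ 2 * (2 / n%:R * L)).
    by rewrite /w expr_div_n !exprMn q2 -natrX.
  by field; rewrite !gt_eqF.
rewrite expRN lnK ?posrE ?(lt_trans _ md0)//.
by rewrite invf_div mulrCA divff ?mulr1// gt_eqF// (lt_le_trans _ m0).
Qed.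

Theorem theorem3 (R : realType) (n m1 m2 : nat)
  (hn : (1 <= n)%N) (hm1 : (1 <= m1)%N) (hm2 : (1 <= m2)%N)
  (X : 'I_n -> 'M[R]_(m1, m2)) (Bstar : 'M[R]_(m1, m2))
  (sigma : R) (hsigma : 0 < sigma)
  (d : measure_display) (Omega : measurableType d) (P : probability Omega R)
  (xi : {RV P >-> n.-tuple R})
  (hxi : forall A : set (n.-tuple R), measurable A ->
     distribution P xi A = iid_normal sigma A)
  (y : Omega -> 'I_n -> R)
  (hy : forall w i, y w i = \tr ((X i)^T *m Bstar) + tnth (xi w) i)
  (V1 : forall B : 'M[R]_(m1, m2), 'M[R]_(m1, \rank B))
  (Sg : forall B : 'M[R]_(m1, m2), 'rV[R]_(\rank B))
  (V2 : forall B : 'M[R]_(m1, m2), 'M[R]_(m2, \rank B))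
  (hsvd : forall B : 'M[R]_(m1, m2), is_svd B (V1 B) (Sg B) (V2 B))
  (tau lam delta : R) (htau : 0 < tau) (hlam : 0 < lam)
  (hdelta0 : 0 < delta) (hdelta1 : delta < 1)
  (hlamv : 2 * sigma * design_const X *
     Num.sqrt (2 / n%:R * ln ((m1 + m2)%:R / delta)) <= lam) :
  ((1 - delta)%:E <=
   P [set w : Omega |
     ((pred_loss X (EWA X (y w) lam tau) Bstar)%:E <=
      ereal_inf [set x : \bar R |
        exists (B : 'M[R]_(m1, m2)) (J : {set 'I_(\rank B)}),
          x = (pred_loss X B Bstar)%:E
              + (4 * lam * nuclear_norm (projc (V1 B) (V2 B) J B))%:E
              + (9 * lam ^+ 2 * #|J|%:R)%:E
                / (4%:E * compat X (V1 B) (V2 B) J 3)]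
      + (2 * (m1 * m2)%:R * tau)%:E)%E])%E.
Proof.
(* The decompositions fixed in the statement are the source of existence for all the lemmas on the
   nuclear norm. *)
have svdP B : exists r (W1 : 'M[R]_(m1, r)) s (W2 : 'M[R]_(m2, r)), is_svd B W1 s W2.
  by exists (\rank B), (V1 B), (Sg B), (V2 B).
have [E mE [PE noise]] := noise_event hn hm1 hsigma hlam hdelta0 hdelta1 hlamv.
set c := (ereal_inf _ + _)%E.
have my i : measurable_fun setT (fun w => y w i).
  under eq_fun do rewrite hy; apply: measurable_funD => //.
  exact: measurableT_comp (measurable_tnth _) (measurable_funPT xi).
have mloss := measurable_pred_loss_EWA X hlam htau svdP my Bstar.
(* Monotonicity of [P] needs this event to be measurable; [c] does not depend on [w], so it is a
   sublevel set of the loss. *)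
have mS : measurable [set w | ((pred_loss X (EWA X (y w) lam tau) Bstar)%:E <= c)%E].
  have /measurable_EFinP/(_ measurableT _ (emeasurable_itv `]-oo, c])) := mloss.
  rewrite setTI; congr measurable; apply/seteqP; split => w /=; rewrite in_itv//=.
apply: le_trans PE _; rewrite -hxi//.
rewrite (_ : distribution P xi E = P (xi @^-1` E))//; apply: le_measure; rewrite ?inE//.
  by rewrite -[X in measurable X]setTI; exact: (measurable_funPT xi).
move=> w /= /noise wE; rewrite -leeBlDr//; apply: le_ereal_inf_tmp => _ [B [J ->]].
by rewrite leeBlDr//; exact: (oracle_inequality hn hlam htau svdP (hy w) wE J (hsvd B)).
Qed.
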